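(* Let $X_1,X_2$ be Polish spaces, let $H:\mathfrak C[X_1]\times\mathfrak C[X_2]\to[0,+\infty]$ be a proper, radially $1$-homogeneous and continuous function, and let $\mu_i\in\mathcal M_+(X_i)$, $i=1,2$, with $\mu_1$ diffuse (i.e. $\mu_1(\{x\})=0$ for every $x\in X_1$) and such that $\mu_1(X_1)>0$. Then $$\mathcal U_H(\mu_1,\mu_2)=\mathcal M\!on_H(\mu_1,\mu_2),$$ where $$\mathcal U_H(\mu_1,\mu_2)=\inf\Big\{\int_{\mathfrak C[X_1]\times\mathfrak C[X_2]} H\,d\alpha:\alpha\in\mathfrak H^1(\mu_1,\mu_2)\Big\}$$ and $$\mathcal M\!on_H(\mu_1,\mu_2)=\inf\Big\{\int_{X_1}H([x,1],[T(x),g(x)])\,d\mu_1(x):\ (T,g)\ \text{Borel},\ \mu_2=T_\sharp(g\mu_1)\Big\},$$ the last infimum being over Borel maps $(T,g):X_1\to X_2\times[0,+\infty)$ with $g\in L^1(X_1,\mu_1)$.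
   Context: $\mathcal M_+(X)$ is the set of finite nonnegative Borel (equivalently Radon, $X$ being Polish) measures on $X$. Here $T_\sharp(g\mu_1)(B)=\int_{T^{-1}(B)}g\,d\mu_1$. Infima over empty sets are $+\infty$. Cone: $\mathfrak C[X]=(X\times[0,+\infty))/\sim$, where $(x,r)\sim(y,s)$ iff ($x=y$ and $r=s\neq0$) or $r=s=0$. The class of $(x,r)$ is $[x,r]$, and $\mathfrak o=[x,0]$ is the vertex. A neighbourhood base at $[x,r]$ with $r>0$ is given by the images of the neighbourhoods of $(x,r)$ in the product topology; a neighbourhood base at $\mathfrak o$ is given by the sets $\{[x,r]:0\le r<\varepsilon\}$, $\varepsilon>0$. $\mathfrak C[X_1]\times\mathfrak C[X_2]$ has the product topology. $H$ is proper if not identically $+\infty$, and radially $1$-homogeneous if $H([x_1,\lambda r_1],[x_2,\lambda r_2])=\lambda H([x_1,r_1],[x_2,r_2])$ for all $\lambda>0$, $x_i\in X_i$, $r_i\ge0$. Continuity of $H$ is meant as a map with values in $[0,+\infty]$. $\mathfrak H^1(\mu_1,\mu_2)$ is the set of nonnegative finite Radon measures $\alpha$ on $\mathfrak C[X_1]\times\mathfrak C[X_2]$ with $\int(r_1+r_2)\,d\alpha<+\infty$ and $\mu_i(A)=\int_{\{r_i>0,\ x_i\in A\}}r_i\,d\alpha([x_1,r_1],[x_2,r_2])$ for every Borel $A\subset X_i$, $i=1,2$. *)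

(* Defs.v *)
From HB Require Import structures.
From mathcomp Require Import all_boot all_order all_algebra.
From mathcomp Require Import all_classical all_reals all_analysis.

Set Implicit Arguments.
Unset Strict Implicit.
Unset Printing Implicit Defensive.

Import Order.TTheory GRing.Theory Num.Theory.
Import numFieldNormedType.Exports.

Local Open Scope classical_set_scope.
Local Open Scope ring_scope.
Local Open Scope quotient_scope.

Definition polish_space (R : realType) (X : topologicalType) : Prop :=
  (exists2 D : set X, countable D & dense D) /\
  exists (M : metricType R) (f : X -> M) (g : M -> X),
    [/\ cancel f g, cancel g f, continuous f, continuous g &
        forall F : set_system M, ProperFilter F -> cauchy F ->
          exists x : M, F --> x].

(* A measurable type is pointed by definition, whence the pointed X: this only
   excludes the empty space, over which the cone is empty too and no function on
   it is proper. *)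
Definition borel (X : ptopologicalType) : Type := g_sigma_algebraType (@open X).
HB.instance Definition _ (X : ptopologicalType) :=
  Measurable.copy (borel X) (g_sigma_algebraType (@open X)).

(* In a Hausdorff space compact sets are Borel, so the requirement that K be
   measurable is void; it is there because the values of m on non-measurable sets
   are meaningless. *)
Definition radon (R : realType) (X : ptopologicalType)
    (m : {finite_measure set (borel X) -> \bar R}) : Prop :=
  forall A : set (borel X), measurable A ->
    m A = ereal_sup [set m K | K in
      [set K : set (borel X) | [/\ compact (K : set X), measurable K & K `<=` A]]].

Definition diffuse (R : realType) (X : ptopologicalType)
    (m : {finite_measure set (borel X) -> \bar R}) : Prop :=
  forall x : X, m [set x] = 0%E.

HB.instance Definition _ (R : realType) := Topological.copy {nonneg R}
  (initial_topology (fun r : {nonneg R} => r%:num)).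
HB.instance Definition _ (R : realType) := isPointed.Build {nonneg R} 0%:nng.

(* Needed to combine the existing pointed and product topology structures. *)
HB.instance Definition _ (X Y : ptopologicalType) := Pointed.on (X * Y)%type.

Section cone.
Context (R : realType) (X : topologicalType).

Definition cone_rel : rel (X * {nonneg R}) := fun p q =>
  [|| [&& p.1 == q.1, p.2 == q.2 & p.2%:num != 0]
    | (p.2%:num == 0) && (q.2%:num == 0)].

Lemma cone_rel_refl : reflexive cone_rel.
Proof. by case=> x r; rewrite /cone_rel !eqxx /=; case: eqP. Qed.

Lemma cone_rel_sym : symmetric cone_rel.
Proof.
case=> x r [y s]; rewrite /cone_rel /= [y == x]eq_sym [s == r]eq_sym.
rewrite [(s%:num == 0) && _]andbC; congr orb.
by have [->|] := eqVneq r s.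
Qed.

Lemma cone_rel_trans : transitive cone_rel.
Proof.
case=> y s [x r] [z t]; rewrite /cone_rel /=.
case/orP => [/and3P[/eqP-> /eqP-> s0]|/andP[-> /eqP s0]].
- case/orP => [/and3P[/eqP-> /eqP-> ->]|/andP[/eqP s0']]; first by rewrite !eqxx.
  by rewrite s0' eqxx in s0.
- case/orP => [/and3P[_ _]|/andP[_ ->]]; first by rewrite s0 eqxx.
  by rewrite orbT.
Qed.

Canonical cone_equiv :=
  EquivRel cone_rel cone_rel_refl cone_rel_sym cone_rel_trans.

Definition cone : Type := {eq_quot cone_equiv}.
HB.instance Definition _ := Choice.on cone.
HB.instance Definition _ := EqQuotient.on cone.

Definition cone_pt (x : X) (r : {nonneg R}) : cone := \pi_cone (x, r).

Definition cone_radius (p : cone) : R := (repr p).2%:num.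

(* Meaningful only away from the vertex. *)
Definition cone_base (p : cone) : X := (repr p).1.

Lemma cone_pt_repr (p : cone) : cone_pt (repr p).1 (repr p).2 = p.
Proof. by rewrite /cone_pt -surjective_pairing reprK. Qed.

Lemma cone_pt_eqP (x y : X) (r s : {nonneg R}) :
  cone_pt x r = cone_pt y s <->
  [/\ x = y, r = s & r%:num <> 0] \/ (r%:num = 0 /\ s%:num = 0).
Proof.
have -> : (cone_pt x r = cone_pt y s) = cone_rel (x, r) (y, s) :> Prop.
  apply/propext; rewrite /cone_pt; split => [/eqmodP//|h]; exact/eqmodP.
rewrite /cone_rel /=; split.
- case/orP => [/and3P[/eqP ? /eqP ? /eqP ?]|/andP[/eqP ? /eqP ?]];
  by [left | right].
- case=> [[-> -> /eqP ->]|[-> ->]]; by rewrite !eqxx ?orbT.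
Qed.

Lemma cone_radiusE (x : X) (r : {nonneg R}) : cone_radius (cone_pt x r) = r%:num.
Proof.
have := cone_pt_repr (cone_pt x r); rewrite cone_pt_eqP /cone_radius.
by case=> [[_ -> _]//|[-> ->]].
Qed.

Lemma cone_baseE (x : X) (r : {nonneg R}) :
  r%:num <> 0 -> cone_base (cone_pt x r) = x.
Proof.
move=> r0; have := cone_pt_repr (cone_pt x r); rewrite cone_pt_eqP /cone_base.
by case=> [[-> _ _]//|[_ /r0]].
Qed.

Lemma cone_radius_ge0 (p : cone) : 0 <= cone_radius p.
Proof. by rewrite /cone_radius. Qed.

Lemma repr_cone_pt (x : X) (r : {nonneg R}) :
  r%:num <> 0 -> repr (cone_pt x r) = (x, r).
Proof.
move=> r0; have := cone_pt_repr (cone_pt x r); rewrite cone_pt_eqP.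
by case=> [[+ + _]|[_ /r0]//]; case: repr => /= ? ? -> ->.
Qed.

(* Strictly coarser at the vertex than the quotient topology, in general. *)
Definition cone_nbhs (p : cone) : set_system cone :=
  if cone_radius p == 0
  then filter_from [set e : R | 0 < e] (fun e => [set q | cone_radius q < e])
  else \pi_cone @ nbhs (repr p).

HB.instance Definition _ := hasNbhs.Build cone cone_nbhs.

Let cone_nbhs_filter (p : cone) : ProperFilter (nbhs p).
Proof.
rewrite /nbhs/= /cone_nbhs; case: eqP => [p0|_]; last exact: fmap_proper_filter.
apply: filter_from_proper => [|e /= e0]; last by exists p; rewrite /= p0.
apply: filter_from_filter; first by exists 1; exact: ltr01.
move=> e f /= e0 f0; exists (Num.min e f); first by rewrite /= lt_min e0.
by move=> q /=; rewrite lt_min => /andP.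
Qed.

Let cone_nbhs_singleton (p : cone) (A : set cone) : nbhs p A -> A p.
Proof.
rewrite /nbhs/= /cone_nbhs; case: eqP => [p0 [e /= e0]|_]; first by apply; rewrite /= p0.
by move=> /nbhs_singleton/=; rewrite reprK.
Qed.

Lemma open_radius_ltgt (a b : R) :
  open [set z : X * {nonneg R} | a < z.2%:num < b].
Proof.
have -> : [set z : X * {nonneg R} | a < z.2%:num < b] =
    snd @^-1` ((fun r : {nonneg R} => r%:num) @^-1` `]a, b[).
  by apply/seteqP; split=> z /=; rewrite in_itv.
apply: open_comp => [z _|]; first exact: cvg_snd.
by exists `]a, b[%classic => //; exact: interval_open.
Qed.

Let cone_nbhs_nbhs (p : cone) (A : set cone) : nbhs p A -> nbhs p (nbhs^~ A).
Proof.
have pos (z : X * {nonneg R}) : 0 < z.2%:num -> nbhs z (\pi_cone @^-1` A) ->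
    nbhs (\pi_cone z) A.
  case: z => x r /= r0; rewrite {2}/nbhs/= /cone_nbhs -/(cone_pt x r) cone_radiusE.
  by rewrite gt_eqF// repr_cone_pt//; apply/eqP; rewrite gt_eqF.
rewrite {1 2}/nbhs/= /cone_nbhs; case: eqP => [p0 [e /= e0 eA]|/eqP p0 pA].
- exists e => // q /= qe; have [q0|q0] := eqVneq (cone_radius q) 0.
    by rewrite /nbhs/= /cone_nbhs q0 eqxx; exists e.
  rewrite -(reprK q); apply: pos; first by rewrite lt_neqAle eq_sym q0/=.
  apply: (@filterS _ _ _ [set z : X * {nonneg R} | -1 < z.2%:num < e]).
    move=> [x r] /= /andP[_ re]; apply: eA => /=.
    by rewrite -/(cone_pt x r) cone_radiusE.
  apply: open_nbhs_nbhs; split; first exact: open_radius_ltgt.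
  by rewrite /= qe andbT (lt_le_trans _ (cone_radius_ge0 q))// ltrN10.
- have p1 : 0 < cone_radius p by rewrite lt_neqAle eq_sym p0 cone_radius_ge0.
  have : nbhs (repr p) [set z : X * {nonneg R} | 0 < z.2%:num < cone_radius p + 1].
    apply: open_nbhs_nbhs; split; first exact: open_radius_ltgt.
    by rewrite /= p1 ltrDl ltr01.
  move/nbhs_interior : (pA); rewrite /nbhs_simpl/=; apply: filterS2.
  by move=> z zA /= /andP[z0 _]; exact: pos.
Qed.

HB.instance Definition _ := Nbhs_isNbhsTopological.Build cone
  cone_nbhs_filter cone_nbhs_singleton cone_nbhs_nbhs.

Lemma nbhs_cone_pt (x : X) (r : {nonneg R}) : 0 < r%:num ->
  nbhs (cone_pt x r) =
  filter_from (nbhs (x, r)) (fun V => (fun z => cone_pt z.1 z.2) @` V).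
Proof.
move=> r0; rewrite /nbhs/= /cone_nbhs cone_radiusE gt_eqF//.
rewrite repr_cone_pt; last by apply/eqP; rewrite gt_eqF.
apply/seteqP; split => A.
- move=> hA; exists (\pi_cone @^-1` A) => //.
  by move=> _ [[y s] /= + <-].
- move=> [V hV VA]; apply: (filterS _ hV) => -[y s] Vys /=.
  by apply: VA; exists (y, s).
Qed.

Lemma nbhs_cone_vertex (x : X) : nbhs (cone_pt x 0%:nng) =
  filter_from [set e : R | 0 < e]
    (fun e => [set p | exists y (r : {nonneg R}), r%:num < e /\ p = cone_pt y r]).
Proof.
rewrite /nbhs/= /cone_nbhs cone_radiusE eqxx.
apply/seteqP; split => A [e e0 eA]; exists e => //.
- by move=> _ [y [r [re ->]]]; apply: eA; rewrite /= cone_radiusE.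
- by move=> p /= pe; apply: eA; exists (repr p).1, (repr p).2; rewrite cone_pt_repr.
Qed.

End cone.

HB.instance Definition _ (R : realType) (X : ptopologicalType) :=
  isPointed.Build (cone R X) (cone_pt point 0%:nng).

Section transport.
Context (R : realType) (X1 X2 : ptopologicalType).

Definition radially_homogeneous (H : cone R X1 * cone R X2 -> \bar R) : Prop :=
  forall (l : {posnum R}) (x1 : X1) (x2 : X2) (r1 r2 : {nonneg R}),
    H (cone_pt x1 (l%:num * r1%:num)%:nng, cone_pt x2 (l%:num * r2%:num)%:nng) =
    (l%:num%:E * H (cone_pt x1 r1, cone_pt x2 r2))%E.

Definition homogeneous_plans (mu1 : {finite_measure set (borel X1) -> \bar R})
    (mu2 : {finite_measure set (borel X2) -> \bar R}) :
    set {finite_measure set (borel (cone R X1 * cone R X2)%type) -> \bar R} :=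
  [set alpha : {finite_measure set (borel (cone R X1 * cone R X2)%type) -> \bar R} |
    [/\ radon alpha,
        (\int[alpha]_p (cone_radius p.1 + cone_radius p.2)%:E < +oo)%E,
        forall A : set (borel X1), measurable A -> (mu1 A =
          \int[alpha]_(p in [set p | 0 < cone_radius p.1 /\ A (cone_base p.1)]%R)
            (cone_radius p.1)%:E)%E &
        forall A : set (borel X2), measurable A -> (mu2 A =
          \int[alpha]_(p in [set p | 0 < cone_radius p.2 /\ A (cone_base p.2)]%R)
            (cone_radius p.2)%:E)%E]].

Definition unbalanced_cost (H : cone R X1 * cone R X2 -> \bar R)
    (mu1 : {finite_measure set (borel X1) -> \bar R})
    (mu2 : {finite_measure set (borel X2) -> \bar R}) : \bar R :=
  ereal_inf [set \int[alpha]_p H p | alpha in homogeneous_plans mu1 mu2]%E.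

Definition transport_growth_maps
    (mu1 : {finite_measure set (borel X1) -> \bar R})
    (mu2 : {finite_measure set (borel X2) -> \bar R}) :
    set (X1 -> X2 * {nonneg R}) :=
  [set Tg |
    [/\ measurable_fun [set: borel X1]
          (Tg : borel X1 -> borel (X2 * {nonneg R})%type),
        mu1.-integrable [set: borel X1] (fun x => (Tg x).2%:num%:E) &
        forall B : set (borel X2), measurable B ->
          (mu2 B = \int[mu1]_(x in (fun x => (Tg x).1) @^-1` B)
                     (Tg x).2%:num%:E)%E]].

Definition monge_cost (H : cone R X1 * cone R X2 -> \bar R)
    (mu1 : {finite_measure set (borel X1) -> \bar R})
    (mu2 : {finite_measure set (borel X2) -> \bar R}) : \bar R :=
  ereal_inf [set \int[mu1]_x H (cone_pt x 1%:nng, cone_pt (Tg x).1 (Tg x).2)%R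
            | Tg in transport_growth_maps mu1 mu2]%E.

End transport.

(* Main.v *)
Require Import Defs.
From HB Require Import structures.
From mathcomp Require Import all_boot all_order all_algebra.
From mathcomp Require Import all_classical all_reals all_analysis.
From mathcomp Require Import measurable_realfun.
From mathcomp Require Import lra ring zify.

Set Implicit Arguments.
Unset Strict Implicit.
Unset Printing Implicit Defensive.

Import Order.TTheory GRing.Theory Num.Theory.
Import numFieldNormedType.Exports.

Local Open Scope classical_set_scope.
Local Open Scope ring_scope.

(** The inequality [unbalanced_cost <= monge_cost] holds because a pair (T, g)
    induces the plan which is the image of mu1 under x |-> ([x, 1], [T x, g x]).
    It is Radon, being a continuous image of a finite Borel measure on a Polish
    space ([unbalanced_le_monge]).

    For the converse, let alpha be a plan of finite cost and eps > 0; a pair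
    (T, g) with the exact marginals and cost at most the cost of alpha plus eps
    is built in three steps.

    - Normal form ([plan_normal_form]). By homogeneity the points with r1 > 0 can
      be rescaled to r1 = 1, which turns this part of alpha into a measure gamma
      on X1 x (X2 x [0, +oo)) with first marginal mu1 and cost H([x, 1], [y, r]).
      The points with r1 = 0 < r2 leave a measure nu on X2, produced out of the
      vertex at cost H(o, [y, 1]).

    - Absorption ([absorb_singular_part]). The measure nu must be fed by mass of
      mu1, and very little of it suffices: mass w on x, sent to y with growth
      1 / w, costs H([x, w], [y, 1]), which tends to H(o, [y, 1]) as w tends to 0,
      uniformly in x because neighbourhoods of the vertex only restrict the
      radius. The mass is taken from gamma on a set K where, by continuity of H,
      replacing [x, 1] by [x, 1 - s] hardly changes the cost for all small s.
      Since gamma has positive mass and finite cost, some K has positive mass.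

    - From couplings to maps ([monge_approximation]). For a continuous cost with
      values in [0, +oo], a coupling of a diffuse measure with a measure on a
      Polish space can be replaced by a map with the same marginals and almost the
      same cost. Countably many open rectangles P x Q on which the cost oscillates
      by at most eps cover the set where it is finite; let R_n be a disjoint
      refinement. It suffices to find disjoint sets E_n with E_n included in P_n
      and mu1(E_n) = gamma(R_n), covering almost everything, and then to transport
      mu1 on E_n to the second marginal of gamma on R_n ([diffuse_transport]). As
      the cost may be infinite elsewhere, a point may only be sent to rectangles
      that contain it, and there are infinitely many of them: the existence of
      the E_n is the heart of the proof ([diffuse_selection]). *)

(** * Finite measures and the intermediate value property *)

Section finite_measures.
Local Open Scope ereal_scope.

Lemma exists_finite_measure d (T : measurableType d) (R : realType)
    (m : set T -> \bar R) :
  m set0 = 0 -> (forall A, 0 <= m A) -> semi_sigma_additive m ->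
  m setT < +oo ->
  exists nu : {finite_measure set T -> \bar R}, forall A, nu A = m A.
Proof.
move=> m0 mge0 madd mfin.
pose m1 : {measure set T -> \bar R} := HB.pack m
  (isMeasure.Build _ _ _ m m0 mge0 madd).
have m1fin : fin_num_fun m1.
  apply: lty_fin_num_fun; exact: mfin.
by exists (HB.pack_for (FiniteMeasure.type T R) (Measure.sort m1)
  (Measure_isFinite.Build _ _ _ m1 m1fin)).
Qed.

Lemma exists_image_measure d d' (T : measurableType d) (T' : measurableType d')
    (R : realType) (m : {finite_measure set T -> \bar R}) (f : T -> T') :
  measurable_fun setT f ->
  exists nu : {finite_measure set T' -> \bar R},
    forall A, nu A = pushforward m f A.
Proof.
move=> mf; apply: exists_finite_measure.
- by rewrite /pushforward preimage_set0 measure0.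
- by move=> A; rewrite /pushforward.
- move=> F mF tF mUF; rewrite /pushforward preimage_bigcup.
  have mfF n : measurable (f @^-1` F n) by rewrite -[X in measurable X]setTI; exact: mf.
  apply: measure_semi_sigma_additive => //; last exact: bigcup_measurable.
  by apply/trivIsetP => i j _ _ ij; rewrite -preimage_setI;
    move/trivIsetP : tF => /(_ _ _ I I ij) ->; rewrite preimage_set0.
- by rewrite /pushforward preimage_setT -ge0_fin_numE// fin_num_measure.
Qed.

Section bisection.
Context d (T : measurableType d) (R : realType).
Implicit Types (m : {measure set T -> \bar R}) (U : nat -> set T).

(** Diffuseness in terms of a separating sequence, such as a countable base: a set
    that no [U n] splits is then at most a point. In this form diffuseness makes
    sense for any measurable space and is inherited by dominated measures. *)
Definition diffuse_along m U : Prop :=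
  (forall n, measurable (U n)) /\
  forall A, measurable A -> (forall n, A `<=` U n \/ A `<=` ~` U n) -> m A = 0.

Lemma diffuse_along_le m m' U :
  (forall A, measurable A -> m' A <= m A) ->
  diffuse_along m U -> diffuse_along m' U.
Proof.
move=> m'm [mU null]; split=> // A mA UA; apply/eqP.
by rewrite -measure_le0 -(null A mA UA) m'm.
Qed.

(** Bisection between [L `<=` H] with [m L <= t <= m H]: the difference is cut
    along [U n], and the half on which the value [t] is crossed is kept. In the
    limit the difference is split by no [U n], so it is null. *)
Lemma diffuse_intermediate_value m U A t :
  diffuse_along m U -> measurable A -> m A < +oo -> 0 <= t <= m A ->
  exists B, [/\ measurable B, B `<=` A & m B = t].
Proof.
move=> [mU null] mA Afin /andP[t0 tA].
pose step (p : set T * set T) n :=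
  let M := p.1 `|` (p.2 `&` U n) in
  if m M <= t then (M, p.2) else (p.1, M).
pose LH := fix LH n := if n is k.+1 then step (LH k) k else (set0, A).
pose L n := (LH n).1; pose H n := (LH n).2.
have inv n : [/\ measurable (L n), measurable (H n), L n `<=` H n &
    m (L n) <= t <= m (H n)].
  rewrite /L /H; elim: n => [|n [mL mH LsubH /andP[Lt tH]]] /=.
    by split=> //; rewrite measure0 t0.
  have mM : measurable ((LH n).1 `|` (LH n).2 `&` U n).
    by apply: measurableU => //; exact: measurableI.
  rewrite /step; case: ifPn => [Mt|tM] /=; split => //.
  - by move=> x [/LsubH|[]].
  - by rewrite Mt tH.
  - by rewrite Lt/= ltW// ltNge.
have Lnd : nondecreasing_seq L.
  apply/nondecreasing_seqP => n; apply/subsetPset.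
  by rewrite /L /= /step; case: ifPn => _ /= x Lx //; left.
have Hni : nonincreasing_seq H.
  apply/nonincreasing_seqP => n; apply/subsetPset.
  have [_ _ LsubH _] := inv n; move: LsubH.
  by rewrite /L /H /= /step; case: ifPn => _ /= LsubH x // [/LsubH|[]].
have mL n : measurable (L n) by have [] := inv n.
have mH n : measurable (H n) by have [] := inv n.
pose Loo := \bigcup_n L n; pose Hoo := \bigcap_n H n.
have mLoo : measurable Loo by exact: bigcup_measurable.
have mHoo : measurable Hoo by exact: bigcap_measurable.
have LH_le i j : L i `<=` H j.
  move=> x Lx; have [_ _ sub _] := inv (maxn i j).
  have /subsetPset L' := Lnd _ _ (leq_maxl i j).
  have /subsetPset H' := Hni _ _ (leq_maxr i j).
  exact/H'/sub/L'.
have LsubH : Loo `<=` Hoo by move=> x [i _ Lx] j _; exact: LH_le Lx.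
have HA : Hoo `<=` A by move=> x /(_ 0%N I).
have LA : m Loo <= t.
  have cvgL := @nondecreasing_cvg_mu _ _ _ m _ mL mLoo Lnd.
  rewrite -(cvg_lim _ cvgL)//; apply: lime_le.
    by apply/cvg_ex; eexists; exact: cvgL.
  by apply: nearW => n /=; have [_ _ _ /andP[]] := inv n.
have tHoo : t <= m Hoo.
  have H0 : m (H 0%N) < +oo by [].
  have cvgH := nonincreasing_cvg_mu H0 mH mHoo Hni.
  rewrite -(cvg_lim _ cvgH)//; apply: lime_ge.
    by apply/cvg_ex; eexists; exact: cvgH.
  by apply: nearW => n /=; have [_ _ _ /andP[]] := inv n.
have D0 : m (Hoo `\` Loo) = 0.
  apply: null; first exact: measurableD.
  move=> n; have : H n.+1 `\` L n.+1 `<=` U n \/ H n.+1 `\` L n.+1 `<=` ~` U n.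
    rewrite /H /L /= /step; case: ifPn => _ /=; [right|left].
      by move=> x [Hx /not_orP[_ /not_andP[]]].
    by move=> x [[//|[]]].
  have sub : Hoo `\` Loo `<=` H n.+1 `\` L n.+1.
    move=> x [Hx Lx]; split; first exact: Hx.
    by move=> Lnx; apply: Lx; exists n.+1.
  by case=> h; [left|right]; exact: subset_trans h.
exists Loo; split => //; first exact: subset_trans HA.
apply/eqP; rewrite eq_le LA/= (le_trans tHoo)//.
have -> : m Hoo = m (Hoo `\` Loo) + m (Hoo `&` Loo) by exact: measureDI.
by rewrite D0 add0e measureIr.
Qed.

End bisection.

End finite_measures.

(** * Selecting disjoint sets of prescribed mass *)

Section reservoir.
Local Open Scope ereal_scope.
Context d (T : measurableType d) (R : realType).
Variables (m : {finite_measure set T -> \bar R}) (U : nat -> set T).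
Hypothesis mU : diffuse_along m U.
Variables (lam : {measure set T -> \bar R}^nat) (P : nat -> set T).
Hypothesis mP : forall n, measurable (P n).
Hypothesis lamP : forall n, lam n (~` P n) = 0.
Hypothesis lamE : forall A, measurable A -> m A = \sum_(n <oo) lam n A.

Let Lam n : {measure set T -> \bar R} := msum lam n.

Let LamS n A : Lam n.+1 A = Lam n A + lam n A.
Proof. by rewrite /Lam /= /msum big_ord_recr. Qed.

Let Lam_le n A : measurable A -> Lam n A <= m A.
Proof.
move=> mA; rewrite lamE// /Lam /= /msum -(big_mkord predT (fun k => lam k A)).
exact: nneseries_lim_ge.
Qed.

Let Lam_fin n A : measurable A -> Lam n A < +oo.
Proof.
move=> mA; apply: le_lt_trans (Lam_le n mA) _.
by rewrite -ge0_fin_numE// fin_num_measure.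
Qed.

Let lam_fin n A : measurable A -> lam n A \is a fin_num.
Proof.
move=> mA; rewrite ge0_fin_numE//; apply: le_lt_trans (Lam_fin n.+1 mA).
by rewrite LamS leeDr.
Qed.

Let lam_restr n A : measurable A -> lam n (A `&` P n) = lam n A.
Proof.
move=> mA; have -> : lam n A = lam n (A `\` P n) + lam n (A `&` P n).
  exact: measureDI.
rewrite (_ : lam n (A `\` P n) = 0) ?add0e//.
apply: (subset_measure0 _ _ _ (lamP n)); [exact: measurableD|exact: measurableC|].
by move=> x [].
Qed.

(** Label [0] stands for points not selected yet: its class is [Lam n]-null. *)
Let quota k := if k is j.+1 then lam j setT else 0.

Let Inv n (c : T -> nat) := [/\ forall k, measurable (c @^-1` [set k]),
  forall x, (c x <= n)%N, forall j x, c x = j.+1 -> P j x &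
  forall k, (k <= n)%N -> Lam n (c @^-1` [set k]) = quota k].

Let step n c : Inv n c ->
  exists c', Inv n.+1 c' /\ forall x, c' x = c x \/ c' x = n.+1.
Proof.
move=> [mc cn cP cq].
have /choice[B hB] k : exists B, [/\ measurable B,
    B `<=` c @^-1` [set k] `&` P n & Lam n.+1 B = lam n (c @^-1` [set k])].
  apply: (@diffuse_intermediate_value _ _ _ _ U).
  - by apply: diffuse_along_le mU => A mA; exact: Lam_le.
  - exact: measurableI.
  - by apply: Lam_fin; exact: measurableI.
  - by rewrite measure_ge0/= LamS lam_restr// leeDr.
have mB k : measurable (B k) by have [] := hB k.
have Bc k : B k `<=` c @^-1` [set k] by have [_ + _] := hB k; move=> h x /h[].
have BP k : B k `<=` P n by have [_ + _] := hB k; move=> h x /h[].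
have BE k : Lam n.+1 (B k) = lam n (c @^-1` [set k]) by have [] := hB k.
pose D := \bigcup_k B k.
have mD : measurable D by exact: bigcup_measurable.
have DB k : c @^-1` [set k] `&` D = B k.
  apply/seteqP; split=> x; last by move=> Bx; split; [exact: Bc|exists k].
  by move=> [/= ck [k' _ Bk'x]]; rewrite -ck (Bc _ _ Bk'x : c x = k').
pose c' x := if x \in D then n.+1 else c x.
have c'k k : (k <= n)%N -> c' @^-1` [set k] = c @^-1` [set k] `\` D.
  move=> kn; apply/seteqP; split=> x; rewrite /= /c'; case: ifPn.
  - by move=> _ nk; move: kn; rewrite -nk ltnn.
  - by rewrite notin_setE.
  - by rewrite inE => Dx [].
  - by move=> _ [].
have c'n : c' @^-1` [set n.+1] = D.
  apply/seteqP; split=> x; rewrite /= /c'; last by move=> Dx; rewrite mem_set.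
  by case: ifPn => [/set_mem//|_ cx]; have := cn x; rewrite cx ltnn.
exists c'; split; last by move=> x; rewrite /c'; case: ifP; [right|left].
split.
- move=> k; have [kn|nk] := leqP k n; first by rewrite c'k//; exact: measurableD.
  have [->|kn1] := eqVneq k n.+1; first by rewrite c'n.
  rewrite (_ : c' @^-1` [set k] = set0)// -subset0 => x /=; rewrite /c'.
  case: ifPn => [_ nk1|_ ck]; first by rewrite nk1 eqxx in kn1.
  by have := cn x; rewrite ck leqNgt nk.
- by move=> x; rewrite /c'; case: ifP => // _; exact: leqW.
- move=> j x; rewrite /c'; case: ifPn => [/set_mem[k _ /BP Px] [<-]//|_].
  exact: cP.
- move=> k; rewrite leq_eqVlt => /predU1P[->|]; last first.
    rewrite ltnS => kn; rewrite c'k//.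
    have -> : Lam n.+1 (c @^-1` [set k] `\` D) =
        Lam n.+1 (c @^-1` [set k]) - Lam n.+1 (c @^-1` [set k] `&` D).
      by apply: measureD => //; exact: Lam_fin.
    by rewrite DB BE LamS addeK ?lam_fin// cq.
  have tB : trivIset setT B.
    by move=> i j _ _ [x [/Bc/= <- /Bc/= <-]].
  have tc : trivIset setT (fun k => c @^-1` [set k]).
    by move=> i j _ _ [x [/= <- <-]].
  have cT : \bigcup_k c @^-1` [set k] = setT.
    by rewrite -subTset => x _; exists (c x).
  rewrite c'n /= measure_semi_bigcup// -cT measure_semi_bigcup//.
  by apply: eq_eseriesr => i _; exact: BE.
  by rewrite cT.
Qed.

(** The sets are built by reservoir sampling. After [n] steps a label [c x <= n] is
    attached to each point ([0] for none), and the class of label [j.+1] has mass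
    [lam j setT], measured not by [m] but by the partial sum [Lam n]. To take
    [lam n] into account, every class gives up a subset of [P n] whose
    [Lam n.+1]-mass is the [lam n]-mass of the class; such a subset exists because
    [lam n <= Lam n.+1] lives on [P n]. The old classes keep their mass, now for
    [Lam n.+1], and what they gave up forms a class of mass [lam n setT]. Each
    class shrinks from then on, and [Lam n] increases to [m], so the limits of the
    classes have the required [m]-mass. *)
Lemma diffuse_selection : exists E : nat -> set T,
  [/\ forall n, measurable (E n), trivIset setT E, forall n, E n `<=` P n &
      forall n, m (E n) = lam n setT].
Proof.
have Inv0 : Inv 0%N (cst 0%N).
  split => //.
  - move=> k; rewrite (_ : _ @^-1` _ = if k == 0%N then setT else set0).
      by case: ifP.
    by case: eqP => [->|k0]; apply/seteqP; split => x //= /esym.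
  - by move=> k; rewrite leqn0 => /eqP->; rewrite /Lam /= /msum big_ord0.
have [c [c0 cS]] : exists c : nat -> T -> nat, Inv 0%N (c 0%N) /\
    forall n, Inv n.+1 (c n.+1) /\ forall x, c n.+1 x = c n x \/ c n.+1 x = n.+1.
  pose next n (s : {c | Inv n c}) := cid (step (svalP s)).
  pose f := fix f n : {c | Inv n c} := if n is k.+1 then
    exist _ (sval (next k (f k))) (proj1 (svalP (next k (f k))))
    else exist _ _ Inv0.
  exists (fun n => sval (f n)); split => // n.
  by case: (svalP (next n (f n))).
have cI n : Inv n (c n) by case: n => // n; have [] := cS n.
pose E j := \bigcap_n c (n + j.+1)%N @^-1` [set j.+1].
have mc n k : measurable (c n @^-1` [set k]) by have [] := cI n.
have mE j : measurable (E j) by apply: bigcapT_measurable => n.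
exists E; split => //.
- move=> i j _ _ [x [/(_ j.+1 I)/= ci /(_ i.+1 I)/= cj]].
  by move: ci; rewrite addnC cj => -[].
- by move=> j x /(_ 0%N I) /=; have [_ _ + _] := cI (0 + j.+1)%N; exact.
move=> j.
have decr : nonincreasing_seq (fun n => c (n + j.+1)%N @^-1` [set j.+1]).
  apply/nonincreasing_seqP => n; apply/subsetPset => x /=.
  have [_ /(_ x)[-> //|->]] := cS (n + j.+1)%N.
  by move=> h; exfalso; lia.
have cvgE : m (c (n + j.+1)%N @^-1` [set j.+1]) @[n --> \oo] --> m (E j).
  apply: nonincreasing_cvg_mu => //; last exact: mE.
  by rewrite -ge0_fin_numE// fin_num_measure.
have q n : Lam (n + j.+1)%N (c (n + j.+1)%N @^-1` [set j.+1]) = lam j setT.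
  by have [_ _ _ ->] := cI (n + j.+1)%N => //; rewrite leq_addl.
apply/eqP; rewrite eq_le; apply/andP; split; last first.
  rewrite -(cvg_lim _ cvgE)//; apply: lime_ge.
    by apply/cvg_ex; eexists; exact: cvgE.
  by apply: nearW => n; rewrite -(q n); exact: Lam_le.
(* The excess of [m] over [Lam n] on a class is at most its total excess. *)
have cvgT : lam j setT + (m setT - Lam n setT) @[n --> \oo] --> lam j setT.
  rewrite -[X in _ --> X]adde0; apply: cvgeD; first by rewrite fin_num_adde_defr ?lam_fin.
    exact: cvg_cst.
  rewrite -[X in _ --> X](subee (x := m setT)) ?fin_num_measure//.
  apply: cvgeB; first by rewrite fin_num_adde_defr ?fin_num_measure.
    exact: cvg_cst.
  rewrite lamE//; have := @is_cvg_nneseries _ (fun n => lam n setT) xpredT 0%N.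
  move=> /(_ (fun n _ _ => measure_ge0 _ _))/cvg_ex[l hl].
  rewrite (cvg_lim _ hl)//; apply: cvg_trans hl; apply: near_eq_cvg.
  by apply: nearW => n; rewrite /Lam /= /msum big_mkord.
rewrite -(cvg_lim _ cvgT)//; apply: lime_ge.
  by apply/cvg_ex; eexists; exact: cvgT.
apply: filterS (nbhs_infty_gt j) => n /= jn.
set C := c n @^-1` [set j.+1].
have mC : measurable C by exact: mc.
apply: (@le_trans _ _ (m C)).
  rewrite le_measure ?inE// => x /(_ (n - j.+1)%N I) /=.
  by rewrite subnK.
have mT : m setT = m (~` C) + m C.
  rewrite -(setTD C) -[X in _ + m X]setTI; exact: measureDI.
have LT : Lam n setT = Lam n (~` C) + Lam n C.
  rewrite -(setTD C) -[X in _ + Lam n X]setTI; exact: measureDI.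
have qn : Lam n C = lam j setT by rewrite -(q (n - j.+1)%N) subnK.
have LCle := Lam_le n (measurableC mC).
rewrite -qn mT LT.
have f1 : m C \is a fin_num by rewrite fin_num_measure.
have f2 : m (~` C) \is a fin_num by rewrite fin_num_measure//; exact: measurableC.
have f3 : Lam n C \is a fin_num by rewrite ge0_fin_numE// Lam_fin.
have f4 : Lam n (~` C) \is a fin_num.
  by rewrite ge0_fin_numE// Lam_fin//; exact: measurableC.
move: LCle; rewrite -(fineK f1) -(fineK f2) -(fineK f3) -(fineK f4).
rewrite -!EFinD !lee_fin => h; rewrite opprD addrACA.
lra.
Qed.

End reservoir.

Section splitting.
Local Open Scope ereal_scope.
Context d (T : measurableType d) (R : realType).

(** Multiples of [m] itself are summands that live on the whole space. *)
Lemma diffuse_splitting (m : {finite_measure set T -> \bar R}) U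
    (a : nat -> \bar R) : diffuse_along m U ->
  (forall n, 0 <= a n) -> \sum_(n <oo) a n = m setT ->
  exists E : nat -> set T, [/\ forall n, measurable (E n), trivIset setT E &
    forall n, m (E n) = a n].
Proof.
move=> mU a0 am.
have mT : m setT \is a fin_num by rewrite fin_num_measure.
have a_le n : a n <= m setT.
  rewrite -am; have le_n : \sum_(0 <= k < n.+1) a k <= \sum_(k <oo) a k.
    exact: nneseries_lim_ge.
  apply: le_trans le_n; rewrite big_mkord big_ord_recr/= leeDr//.
  exact: sume_ge0.
have afin n : a n \is a fin_num.
  by rewrite ge0_fin_numE// (le_lt_trans (a_le n))// -ge0_fin_numE.
have r0 n : (0 <= fine (a n) / fine (m setT))%R by rewrite divr_ge0 ?fine_ge0.
pose lam n : {measure set T -> \bar R} := mscale (NngNum (r0 n)) m.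
have lamT n : lam n setT = a n.
  rewrite /lam /= /mscale /= -[X in _ * X](fineK mT) -EFinM.
  have [mT0|mT0] := eqVneq (fine (m setT)) 0%R.
    rewrite mT0 mulr0; apply/esym/eqP; rewrite eq_le a0 andbT.
    by rewrite (le_trans (a_le n))// -(fineK mT) mT0.
  by rewrite divfK// fineK.
have lamE A : measurable A -> m A = \sum_(n <oo) lam n A.
  move=> mA; have -> : \sum_(n <oo) lam n A =
      \sum_(n <oo) ((fine (m setT))^-1 * fine (m A))%:E * a n.
    apply: eq_eseriesr => n _; rewrite /lam /= /mscale /=.
    have fA : m A \is a fin_num by rewrite fin_num_measure.
    rewrite -[X in _ * X = _](fineK fA) -[X in _ = _ * X](fineK (afin n)) -!EFinM.
    by congr EFin; ring.
  rewrite nneseriesZl// am EFinM fineK ?fin_num_measure//.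
  have [mT0|mT0] := eqVneq (fine (m setT)) 0%R.
    have mA0 : m A = 0.
      apply/eqP; rewrite -measure_le0.
      by rewrite (@le_trans _ _ (m setT)) ?le_measure ?inE// -(fineK mT) mT0.
    by rewrite mA0 mule0 mul0e.
  by rewrite muleAC -[X in _ * X * _](fineK mT) -EFinM mulVf// mul1e.
have [||E [mE tE _ EE]] := @diffuse_selection _ _ _ m U mU lam (fun=> setT) _ _ lamE.
- by [].
- by move=> n; rewrite setCT measure0.
by exists E; split => // n; rewrite EE lamT.
Qed.

End splitting.

(** * Labels in the natural numbers *)

Section first_index.
Context {T : Type}.
Implicit Types (V : nat -> set T) (x : T).

(** The value outside the union of the sequence is arbitrary. *)
Definition first_index V x : nat :=
  if pselect (exists k, `[<V k x>]) is left h then ex_minn h else 0%N.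

Lemma first_indexP V k x : V k x -> V (first_index V x) x /\ (first_index V x <= k)%N.
Proof.
move=> Vk; rewrite /first_index; case: pselect => [h|[]]; last first.
  by exists k; apply/asboolP.
case: ex_minnP => j /asboolP Vj jmin; split=> //; exact/jmin/asboolP.
Qed.

End first_index.

Section nat_valued.
Context d (T : measurableType d).

Lemma measurable_first_index (V : nat -> set T) k :
  (forall n, measurable (V n)) -> measurable (first_index V @^-1` [set k]).
Proof.
move=> mV; pose B j := \big[setU/set0]_(i < j) V i.
have mB j : measurable (B j) by exact: bigsetU_measurable.
have -> : first_index V @^-1` [set k] =
    (V k `\` B k) `|` (if k == 0%N then ~` \bigcup_n V n else set0).
  apply/seteqP; split=> x /=.
    move=> <-; have [[j Vj]|noV] := pselect (exists j, V j x).
      left; split; first by have [] := first_indexP Vj.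
      rewrite /B -(@bigcup_mkord _ _ V) => -[i /= ilt Vi].
      by have [_] := first_indexP Vi; rewrite leqNgt ilt.
    right; rewrite ifT; first by move=> [j _ Vj]; apply: noV; exists j.
    rewrite /first_index; case: pselect => // h.
    by exfalso; have [j /asboolP Vj] := h; apply: noV; exists j.
  case=> [[Vk nB]|].
    have [Vi ik] := first_indexP Vk; apply/eqP; rewrite eqn_leq ik/= leqNgt.
    apply/negP => ilt; apply: nB; rewrite /B -(@bigcup_mkord _ _ V).
    by exists (first_index V x).
  case: eqP => // -> nV; rewrite /first_index; case: pselect => // h.
  by exfalso; have [j /asboolP Vj] := h; apply: nV; exists j.
apply: measurableU; first exact: measurableD.
by case: ifP => // _; apply: measurableC; exact: bigcup_measurable.
Qed.

Lemma measurable_preimage_nat (c : T -> nat) (J : set nat) :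
  (forall k, measurable (c @^-1` [set k])) -> measurable (c @^-1` J).
Proof.
move=> mc; have -> : c @^-1` J = \bigcup_(k in J) c @^-1` [set k].
  by apply/seteqP; split=> [x Jx|x [k Jk /= ->]//]; exists (c x).
exact: bigcup_measurable.
Qed.

Lemma measure_preimage_nat (R : realType) (m : {measure set T -> \bar R})
    (c : T -> nat) (J : set nat) (A : set T) :
  (forall k, measurable (c @^-1` [set k])) -> measurable A ->
  (m (c @^-1` J `&` A) =
   \sum_(k <oo | k \in J) m (c @^-1` [set k] `&` A))%E.
Proof.
move=> mc mA; have -> : c @^-1` J `&` A = \bigcup_(k in J) (c @^-1` [set k] `&` A).
  apply/seteqP; split=> [x [Jx Ax]|x [k Jk [/= ck Ax]]]; first by exists (c x).
  by split=> //=; rewrite ck.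
rewrite measure_bigcup//; first by move=> k _; exact: measurableI.
by move=> i j _ _ [x [[/= <- _] [/= <-]]].
Qed.

End nat_valued.

Section coupling.
Local Open Scope ereal_scope.
Context d (T : measurableType d) d' (Y : measurableType d') (R : realType).

Lemma diffuse_relabelling (m : {finite_measure set T -> \bar R}) U
    (a : nat -> \bar R) : diffuse_along m U ->
  (forall n, 0 <= a n) -> \sum_(n <oo) a n = m setT ->
  exists c : T -> nat, (forall n, measurable (c @^-1` [set n])) /\
    forall n, m (c @^-1` [set n]) = a n.
Proof.
move=> mU a0 am; have [E [mE tE Ea]] := diffuse_splitting mU a0 am.
exists (first_index E); have mfE n := measurable_first_index n mE.
split => // n.
have mUE : measurable (\bigcup_n E n) by exact: bigcup_measurable.
have null : m (~` \bigcup_n E n) = 0.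
  rewrite -setTD; have -> : m (setT `\` \bigcup_n E n) =
      m setT - m (setT `&` \bigcup_n E n).
    by apply: measureD => //; rewrite -ge0_fin_numE// fin_num_measure.
  rewrite setTI measure_semi_bigcup//.
  rewrite (eq_eseriesr (g := a)); last by move=> k _; exact: Ea.
  by rewrite am subee// fin_num_measure.
have -> : m (first_index E @^-1` [set n]) = m (first_index E @^-1` [set n] `\` E n)
    + m (first_index E @^-1` [set n] `&` E n) by exact: measureDI.
rewrite (subset_measure0 _ _ _ null) ?add0e//; last 3 first.
- exact: measurableD.
- exact: measurableC.
- move=> x [/= fx nEn] [j _ Ej]; have [Efx _] := first_indexP Ej.
  by move: Efx; rewrite fx.
rewrite (_ : _ `&` E n = E n)//; apply/setIidPr => x En /=.
by have [Ef _] := first_indexP En; apply: (tE _ _ I I); exists x.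
Qed.

(** Only the joint law of two consecutive labels is reproduced. This is enough for
    labels that locate a point at finer and finer scales: consecutive labels decide
    whether the located points form a Cauchy sequence. *)
Lemma diffuse_coupling_step (m : {finite_measure set T -> \bar R}) U
    (nu : {finite_measure set Y -> \bar R}) (c : T -> nat) (p p' : Y -> nat) :
  diffuse_along m U ->
  (forall k, measurable (c @^-1` [set k])) ->
  (forall k, measurable (p @^-1` [set k])) ->
  (forall k, measurable (p' @^-1` [set k])) ->
  (forall k, m (c @^-1` [set k]) = nu (p @^-1` [set k])) ->
  exists c' : T -> nat, (forall k, measurable (c' @^-1` [set k])) /\
    forall k l, m (c @^-1` [set k] `&` c' @^-1` [set l]) =
                nu (p @^-1` [set k] `&` p' @^-1` [set l]).
Proof.
move=> mU mc mp mp' cp.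
have /choice[g hg] k : exists g : T -> nat,
    (forall l, measurable (g @^-1` [set l])) /\
    forall l, m (c @^-1` [set k] `&` g @^-1` [set l]) =
              nu (p @^-1` [set k] `&` p' @^-1` [set l]).
  pose mk : {finite_measure set T -> \bar R} := mrestr m (mc k).
  have mkU : diffuse_along mk U.
    by apply: diffuse_along_le mU => A mA; exact: measureIl.
  have [||g [mg gE]] := @diffuse_relabelling mk U
      (fun l => nu (p @^-1` [set k] `&` p' @^-1` [set l])) mkU.
  - by move=> l; rewrite measure_ge0.
  - rewrite /mk /= /mrestr setTI cp -[X in nu X]setTI.
    rewrite -(preimage_setT p') (measure_preimage_nat nu setT mp' (mp k)).
    rewrite [RHS](@eq_eseriesl _ _ xpredT); last by move=> l; rewrite in_setT.
    by apply: eq_eseriesr => l _; rewrite setIC.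
  - by exists g; split => // l; rewrite -gE setIC.
exists (fun x => g (c x) x); split.
- move=> l; have -> : (fun x => g (c x) x) @^-1` [set l] =
      \bigcup_k (c @^-1` [set k] `&` g k @^-1` [set l]).
    apply/seteqP; split=> [x /= gl|x [k _ [/= -> ->]]//].
    by exists (c x).
  by apply: bigcup_measurable => k _; apply: measurableI => //; have [] := hg k.
- move=> k l; have [_ <-] := hg k.
  by congr (m _); apply/seteqP; split=> x /= [->].
Qed.

End coupling.

(** * Complete separable distances and transport maps *)

Section polish_distance.
Context (R : realType).

(** A complete separable distance as a plain function on the space: products and
    half-lines then need no metric structure of their own. Completeness is
    stated with the explicit rate that geometric series give. *)
Record polish_distance (Z : topologicalType) (d : Z -> Z -> R) (y : nat -> Z)
    : Prop := PolishDistance {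
  pd_refl : forall x, d x x = 0;
  pd_separated : forall x z, d x z = 0 -> x = z;
  pd_sym : forall x z, d x z = d z x;
  pd_triangle : forall x z w, d x w <= d x z + d z w;
  pd_nbhs : forall x A, nbhs x A <->
    exists2 e, 0 < e & forall z, d x z < e -> A z;
  pd_dense : forall x e, 0 < e -> exists k, d x (y k) < e;
  pd_complete : forall u : nat -> Z, (forall n, d (u n) (u n.+1) < 2 ^- n) ->
    exists z, forall n, d (u n) z <= 2 * 2 ^- n }.

Lemma exp2N_gt0 n : 0 < 2 ^- n :> R.
Proof. by rewrite invr_gt0 exprn_gt0. Qed.

Lemma exp2NS n : 2 ^- n = 2 * 2 ^- n.+1 :> R.
Proof. by rewrite exprS invfM mulrA divff ?mul1r// pnatr_eq0. Qed.

Lemma exp2N_lt (e : R) : 0 < e -> exists n, 2 ^- n < e.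
Proof.
move=> e0; exists (Num.truncn e^-1).+1.
rewrite -[ltRHS]invrK ltf_pV2 ?posrE ?exprn_gt0 ?invr_gt0//.
apply: lt_le_trans (truncnS_gt _) _.
rewrite -natrX ler_nat.
exact: (ltnW (ltn_expl (Num.truncn e^-1).+1 (isT : (1 < 2)%N))).
Qed.

Section limits.
Context (Z : topologicalType) (d : Z -> Z -> R) (y : nat -> Z).
Hypothesis dP : polish_distance d y.

Lemma pd_ge0 x z : 0 <= d x z.
Proof.
have := pd_triangle dP x z x; rewrite (pd_refl dP) (pd_sym dP z x); lra.
Qed.

Lemma pd_open_ball x e : open [set z | d x z < e].
Proof.
rewrite openE => z /= xz; apply/(pd_nbhs dP); exists (e - d x z); first by rewrite subr_gt0.
by move=> w zw /=; have := pd_triangle dP x z w; lra.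
Qed.

Lemma pd_openP (U : set Z) z : open U -> U z ->
  exists2 e, 0 < e & forall w, d z w < e -> U w.
Proof. by move=> oU Uz; apply/(pd_nbhs dP); exact: open_nbhs_nbhs. Qed.

(** Geometric convergence to [z] makes membership of [z] in an open set an
    increasing countable union of conditions on the approximants. The factor 4
    exceeds the 2 of [pd_complete] by enough to pass to the next scale. *)
Definition well_inside (U : set Z) n w := forall v, d w v < 4 * 2 ^- n -> U v.

Lemma well_insideS (U : set Z) n w w' : d w w' < 2 ^- n ->
  well_inside U n w -> well_inside U n.+1 w'.
Proof.
move=> ww' h v w'v; apply: h; have := pd_triangle dP w w' v.
have := exp2NS n; have := exp2N_gt0 n; lra.
Qed.

Lemma open_limitP (U : set Z) (u : nat -> Z) z : open U ->
  (forall n, d (u n) z <= 2 * 2 ^- n) ->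
  U z <-> exists n, well_inside U n (u n).
Proof.
move=> oU uz; split=> [Uz|[n]]; last first.
  by apply; have := uz n; have := exp2N_gt0 n; lra.
have [e e0 eU] := pd_openP oU Uz.
have [n ne] : exists n, 2 ^- n < e / 6 by apply: exp2N_lt; rewrite divr_gt0.
exists n => v uv; apply: eU; have := pd_triangle dP z (u n) v.
have := uz n; rewrite (pd_sym dP (u n) z); lra.
Qed.

Definition level n : Z -> nat :=
  first_index (fun k => [set z | d z (y k) < 2 ^- n.+1]).

Lemma levelP n z : d z (y (level n z)) < 2 ^- n.+1.
Proof.
have [k hk] := pd_dense dP z (exp2N_gt0 n.+1).
by have [] := @first_indexP _ (fun k => [set z | d z (y k) < 2 ^- n.+1]) k z hk.
Qed.

Lemma level_step n z : d (y (level n z)) (y (level n.+1 z)) < 2 ^- n.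
Proof.
have := levelP n z; have := levelP n.+1 z.
have := pd_triangle dP (y (level n z)) z (y (level n.+1 z)).
rewrite (pd_sym dP _ z); have := exp2NS n; have := exp2NS n.+1.
have := exp2N_gt0 n.+2; lra.
Qed.

End limits.
End polish_distance.

Section borel_sets.

Lemma open_borel (X : ptopologicalType) (A : set X) :
  open A -> measurable (A : set (borel X)).
Proof. by move=> oA; exact: sub_sigma_algebra. Qed.

Lemma borel_measurable_fun d (T : measurableType d) (X : ptopologicalType)
    (f : T -> borel X) :
  (forall A : set X, open A -> measurable (f @^-1` A)) -> measurable_fun setT f.
Proof.
move=> h; apply: (@measurability _ _ T (borel X) setT f (@open X)) => //.
by move=> _ [A oA <-]; rewrite setTI; exact: h.
Qed.

Lemma borel_measure_unique (R : realType) (X : ptopologicalType)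
    (m1 m2 : {finite_measure set (borel X) -> \bar R}) :
  (forall A : set X, open A -> m1 A = m2 A) ->
  forall A : set (borel X), measurable A -> m1 A = m2 A.
Proof.
move=> h A mA; apply: (@measure_unique _ R (borel X) (@open X) (fun=> setT)) mA => //.
- by move=> B C; exact: openI.
- by move=> _; exact: openT.
- by rewrite bigcup_const.
- by move=> _; rewrite -ge0_fin_numE// fin_num_measure.
Qed.

End borel_sets.

Section transport.
Local Open Scope ereal_scope.
Context d0 (T : measurableType d0) (R : realType) (Z : ptopologicalType).

(** The point [z] is located at scale [n] by the index [level d y n z] of a nearby
    centre. Labels [c n] on the source are given the law of these indices, with
    matching joint laws of consecutive ones. Almost surely consecutive labels are
    then those of an actual point, so the centres [y (c n x)] converge; for an open
    set [A], the events [c n x] well inside [A] increase to [f x] in [A], and have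
    the same masses as their counterparts for [nu]. *)
Lemma diffuse_transport (m : {finite_measure set T -> \bar R}) V
    (d : Z -> Z -> R) (y : nat -> Z)
    (nu : {finite_measure set (borel Z) -> \bar R}) :
  diffuse_along m V -> polish_distance d y -> m setT = nu setT ->
  exists f : T -> borel Z, measurable_fun setT f /\
    forall B : set (borel Z), measurable B -> m (f @^-1` B) = nu B.
Proof.
move=> mV dP mnu.
have ml n k : measurable ((level d y n : borel Z -> nat) @^-1` [set k]).
  apply: measurable_first_index => j; apply: open_borel.
  rewrite [X in open X](_ : _ = [set z | (d (y j) z < 2 ^- n.+1)%R]).
    exact: pd_open_ball dP _ _.
  by apply/seteqP; split=> z /=; rewrite (pd_sym dP).
pose law n (c : T -> nat) := (forall k, measurable (c @^-1` [set k])) /\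
  forall k, m (c @^-1` [set k]) = nu ((level d y n : borel Z -> nat) @^-1` [set k]).
have law_next (c c' : T -> nat) n (p : borel Z -> nat) :
    (forall k, measurable (p @^-1` [set k])) ->
    (forall k, measurable (c @^-1` [set k])) ->
    (forall k, measurable (c' @^-1` [set k])) ->
    (forall k l, m (c @^-1` [set k] `&` c' @^-1` [set l]) =
      nu (p @^-1` [set k] `&` (level d y n : borel Z -> nat) @^-1` [set l])) ->
    law n c'.
  move=> mp mc mc' E; split=> // l.
  rewrite -[X in m X]setTI -(preimage_setT c) (measure_preimage_nat m setT mc (mc' l)).
  rewrite -[X in nu X]setTI -(preimage_setT p) (measure_preimage_nat nu setT mp (ml n l)).
  by apply: eq_eseriesr => k _; exact: E.
have [c0 lc0] : exists c0, law 0%N c0.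
  have mcst d1 (S : measurableType d1) k :
      measurable ((cst 0%N : S -> nat) @^-1` [set k]).
    by rewrite preimage_cst; case: ifP.
  have [|c0 [mc0 E0]] := @diffuse_coupling_step _ T _ (borel Z) R m V nu
      (cst 0%N) (cst 0%N) (level d y 0) mV (mcst _ _) (mcst _ _) (ml 0%N).
    by move=> k; rewrite !preimage_cst; case: ifP => // _; rewrite !measure0.
  by exists c0; apply: law_next E0 => //; exact: mcst.
have next n (s : {c | law n c}) : exists c',
    (forall k l, m (sval s @^-1` [set k] `&` c' @^-1` [set l]) =
      nu ((level d y n : borel Z -> nat) @^-1` [set k] `&`
          (level d y n.+1 : borel Z -> nat) @^-1` [set l])) /\ law n.+1 c'.
  case: s => c [mc lc] /=.
  have [c' [mc' E]] := diffuse_coupling_step mV mc (ml n) (ml n.+1) lc.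
  by exists c'; split => //; exact: law_next E.
pose f := fix f n : {c | law n c} := if n is k.+1 then
    exist _ (sval (cid (next k (f k)))) (proj2 (svalP (cid (next k (f k)))))
    else exist _ _ lc0.
pose c n := sval (f n).
have mc n k : measurable (c n @^-1` [set k]) by have [] := svalP (f n).
have lc n k : m (c n @^-1` [set k]) = nu ((level d y n : borel Z -> nat) @^-1` [set k]).
  by have [] := svalP (f n).
have joint n k l : m (c n @^-1` [set k] `&` c n.+1 @^-1` [set l]) =
      nu ((level d y n : borel Z -> nat) @^-1` [set k] `&`
          (level d y n.+1 : borel Z -> nat) @^-1` [set l]).
  by have [] := svalP (cid (next n (f n))).
clearbody c; clear f next law_next.
(* Pairs of consecutive labels that no point has: they have mass zero. *)
pose bad n k l := c n @^-1` [set k] `&` c n.+1 @^-1` [set l] `&`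
  [set _ | ~ exists z, level d y n z = k /\ level d y n.+1 z = l].
pose N := \bigcup_n \bigcup_k \bigcup_l bad n k l.
have mbad n k l : measurable (bad n k l) /\ m (bad n k l) = 0.
  have [h|h] := pselect (exists z, level d y n z = k /\ level d y n.+1 z = l).
    rewrite /bad (_ : [set _ | _] = set0) ?setI0 ?measure0//.
    by apply/seteqP; split.
  rewrite /bad (_ : [set _ | _] = setT) ?setIT; last by apply/seteqP; split.
  split; first exact: measurableI.
  rewrite joint (_ : _ `&` _ = set0) ?measure0//.
  by rewrite -subset0 => z /= hz; apply: h; exists z.
have mN : measurable N.
  apply: bigcup_measurable => n _; apply: bigcup_measurable => k _.
  by apply: bigcup_measurable => l _; have [] := mbad n k l.
have N0 : m N = 0.
  apply/negligibleP => //; apply: negligible_bigcup => n.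
  apply: negligible_bigcup => k; apply: negligible_bigcup => l.
  by have [? ?] := mbad n k l; apply/negligibleP.
have near_step x n : ~ N x -> (d (y (c n x)) (y (c n.+1 x)) < 2 ^- n)%R.
  move=> Nx; have [[z [<- <-]]|h] := pselect (exists z,
      level d y n z = c n x /\ level d y n.+1 z = c n.+1 x).
    exact: level_step dP _ _.
  by exfalso; apply: Nx; exists n => //; exists (c n x) => //; exists (c n.+1 x).
have /choice[f hf] (x : T) : exists z : Z, (N x -> z = point) /\
    (~ N x -> forall n, (d (y (c n x)) z <= 2 * 2 ^- n)%R).
  have [Nx|Nx] := pselect (N x); first by exists point.
  by have [z hz] := pd_complete dP (fun n => near_step x n Nx); exists z.
pose J (A : set Z) n := [set k | well_inside d A n (y k)].
have fE (A : set Z) : open A -> f @^-1` A `\` N = \bigcup_n (c n @^-1` J A n `\` N).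
  move=> oA; apply/seteqP; split=> x.
    move=> [/= Afx Nx]; have [_ /(_ Nx) hx] := hf x.
    by have [/(_ Afx)[n hn] _] := open_limitP dP oA hx; exists n.
  move=> [n _ [/= hn Nx]]; split => //=; have [_ /(_ Nx) hx] := hf x.
  by have [_] := open_limitP dP oA hx; apply; exists n.
have mJ A n : measurable (c n @^-1` J A n) by exact: measurable_preimage_nat.
have mJN A n : measurable (c n @^-1` J A n `\` N) by exact: measurableD.
have mDN (A : set T) : measurable A -> m (A `\` N) = m A.
  move=> mA; have -> : m A = m (A `\` N) + m (A `&` N) by exact: measureDI.
  by rewrite [X in _ + X](subset_measure0 _ mN _ N0) ?adde0//; exact: measurableI.
have mfA (A : set Z) : open A -> measurable (f @^-1` A).
  move=> oA.
  have -> : f @^-1` A = (f @^-1` A `\` N) `|` (N `&` [set _ | A point]).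
    apply/seteqP; split=> x /=.
      have [Nx|Nx] := pselect (N x); last by left.
      by have [/(_ Nx) -> _] := hf x; right.
    by move=> [[]//|[Nx]]; have [/(_ Nx) -> _] := hf x.
  apply: measurableU; first by rewrite fE//; exact: bigcup_measurable.
  have [Ap|Ap] := pselect (A point).
    by rewrite (_ : [set _ | _] = setT) ?setIT//; apply/seteqP; split.
  by rewrite (_ : [set _ | _] = set0) ?setI0//; apply/seteqP; split.
have mf : measurable_fun setT (f : T -> borel Z) by exact: borel_measurable_fun.
exists f; split => // B mB.
have [mm hmm] : exists mm : {finite_measure set (borel Z) -> \bar R},
    forall A, mm A = pushforward m (f : T -> borel Z) A.
  exact: exists_image_measure.
have -> : m (f @^-1` B) = mm B by rewrite hmm.
apply: borel_measure_unique mB => A oA; rewrite hmm /pushforward -mDN; last exact: mfA.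
have Jincr n x : ~ N x -> (c n @^-1` J A n) x -> (c n.+1 @^-1` J A n.+1) x.
  by move=> Nx; apply: (well_insideS dP); exact: near_step.
pose L n := (level d y n : borel Z -> nat) @^-1` J A n.
have mL n : measurable (L n) by exact: measurable_preimage_nat.
have nuE : (A : set (borel Z)) = \bigcup_n L n.
  have hz z n : (d (y (level d y n z)) z <= 2 * 2 ^- n)%R.
    rewrite (pd_sym dP); have := levelP dP n z.
    have := exp2NS R n; have := exp2N_gt0 R n.+1; lra.
  apply/seteqP; split=> z.
    by move=> Az; have [/(_ Az)[n hn] _] := open_limitP dP oA (hz z); exists n.
  by move=> [n _ hn]; have [_] := open_limitP dP oA (hz z); apply; exists n.
have cvg1 : m (c n @^-1` J A n) @[n --> \oo] --> m (f @^-1` A `\` N).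
  rewrite fE//; under eq_fun do rewrite -mDN//.
  apply: (@nondecreasing_cvg_mu _ _ _ m (fun n => c n @^-1` J A n `\` N)) => //.
    exact: bigcup_measurable.
  apply/nondecreasing_seqP => n; apply/subsetPset => x [Jx Nx].
  by split => //; exact: Jincr.
have cvg2 : m (c n @^-1` J A n) @[n --> \oo] --> nu A.
  have -> : (fun n => m (c n @^-1` J A n)) = nu \o L.
    apply/funext => n /=; rewrite -[X in m X]setIT (measure_preimage_nat m _ (mc n))//.
    rewrite -[X in nu X]setIT (measure_preimage_nat nu _ (ml n))//.
    by apply: eq_eseriesr => k _; rewrite !setIT; exact: lc.
  rewrite nuE; apply: nondecreasing_cvg_mu => //; first exact: bigcup_measurable.
  apply/nondecreasing_seqP => n; apply/subsetPset => z.
  by apply: (well_insideS dP); exact: (level_step dP).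
exact: cvg_unique cvg1 cvg2.
Qed.

End transport.

(** * Borel functions on Polish spaces *)

Section polish_basis.
Context (R : realType) (Z : ptopologicalType) (d : Z -> Z -> R) (y : nat -> Z).
Hypothesis dP : polish_distance d y.

Definition pd_basis n : set Z :=
  if unpickle n is Some (k, j) then [set z | d (y k) z < 2 ^- j] else set0.

Lemma pd_basis_open n : open (pd_basis n).
Proof.
rewrite /pd_basis; case: unpickle => [[k j]|]; last exact: open0.
exact: pd_open_ball dP _ _.
Qed.

Lemma pd_basisP z A : nbhs z A -> exists n, pd_basis n z /\ pd_basis n `<=` A.
Proof.
move=> /(pd_nbhs dP)[e e0 eA].
have [j je] : exists j, 2 ^- j < e / 2 by apply: exp2N_lt; rewrite divr_gt0.
have [k zk] := pd_dense dP z (exp2N_gt0 R j).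
exists (pickle (k, j)); rewrite /pd_basis pickleK /= (pd_sym dP); split => // w /= kw.
by apply: eA; have := pd_triangle dP z (y k) w; lra.
Qed.

Lemma diffuse_along_basis (m : {finite_measure set (borel Z) -> \bar R}) :
  diffuse m -> diffuse_along m pd_basis.
Proof.
move=> mdiff; split=> [n|A mA split_A]; first by apply: open_borel; exact: pd_basis_open.
have [->|/set0P[z Az]] := eqVneq A set0; first by rewrite measure0.
have -> : A = [set z]; last exact: mdiff.
apply/seteqP; split=> [w Aw|w ->//] /=.
apply: contrapT => /eqP wz.
have dzw : 0 < d z w.
  rewrite lt_neqAle (pd_ge0 dP) andbT eq_sym; apply/eqP => /(pd_separated dP) zw.
  by rewrite zw eqxx in wz.
have : nbhs z [set v | d z v < d z w].
  by apply: open_nbhs_nbhs; split; [exact: pd_open_ball dP _ _|rewrite /= (pd_refl dP)].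
move=> /pd_basisP[n [nz nsub]]; case: (split_A n) => sub; last exact: sub _ Az nz.
by have /= := nsub _ (sub _ Aw); rewrite ltxx.
Qed.

End polish_basis.

Section borel_functions.
Context (R : realType).

Lemma continuous_borel (X Z : ptopologicalType) (f : X -> Z) :
  continuous f -> measurable_fun setT (f : borel X -> borel Z).
Proof.
move=> /continuousP cf; apply: borel_measurable_fun => A oA.
by apply: open_borel; exact: cf.
Qed.

Lemma measurable_borel_fst (X Z : ptopologicalType) :
  measurable_fun setT (fst : borel (X * Z)%type -> borel X).
Proof. by apply: continuous_borel => p; exact: cvg_fst. Qed.

Lemma measurable_borel_snd (X Z : ptopologicalType) :
  measurable_fun setT (snd : borel (X * Z)%type -> borel Z).
Proof. by apply: continuous_borel => p; exact: cvg_snd. Qed.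

Lemma continuous_borel_ereal (X : ptopologicalType) (f : X -> \bar R) :
  continuous f -> measurable_fun setT (f : borel X -> \bar R).
Proof.
move=> /continuousP cf.
apply: (measurability _ (ErealGenOInfty.measurableE R)) => // _ [_ [x ->] <-].
rewrite setTI; apply: open_borel; apply: cf.
rewrite [X in open X](_ : _ = [set y | x%:E < y]%E); first exact: open_ereal_gt_ereal.
by apply/seteqP; split=> y /=; rewrite in_itv/= andbT.
Qed.

(** By second countability, an open set of the product is a countable union of
    products of basic sets, so its preimage is measurable. *)
Lemma borel_pair d0 (T : measurableType d0) (X Z : ptopologicalType)
    (dX : X -> X -> R) yX (dZ : Z -> Z -> R) yZ
    (f : T -> borel X) (g : T -> borel Z) :
  polish_distance dX yX -> polish_distance dZ yZ ->
  measurable_fun setT f -> measurable_fun setT g ->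
  measurable_fun setT ((fun t => (f t, g t)) : T -> borel (X * Z)%type).
Proof.
move=> dXP dZP mf mg; apply: borel_measurable_fun => A oA.
pose F n := if unpickle n is Some (a, b) then
    f @^-1` pd_basis dX yX a `&` g @^-1` pd_basis dZ yZ b `&`
      [set _ | pd_basis dX yX a `*` pd_basis dZ yZ b `<=` A]
  else set0.
have -> : (fun t => (f t, g t)) @^-1` A = \bigcup_n F n.
  apply/seteqP; split=> t /=.
    move=> At; have : nbhs (f t, g t) A by apply: open_nbhs_nbhs.
    case=> -[B C] [/= /(pd_basisP dXP)[a [fa aB]] /(pd_basisP dZP)[b [gb bC]]] BC.
    exists (pickle (a, b)) => //; rewrite /F pickleK; split => // p [/aB ? /bC ?].
    exact: BC.
  by rewrite /F => -[n _]; case: unpickle => // -[a b] [[fa gb] sub]; exact: sub.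
apply: bigcup_measurable => n _; rewrite /F; case: unpickle => // -[a b].
have mb (W : ptopologicalType) (h : T -> borel W) (B : set W) :
    measurable_fun setT h -> open B -> measurable (h @^-1` B).
  by move=> mh oB; rewrite -[X in measurable X]setTI; apply: mh => //; exact: open_borel.
have [h|h] := pselect (pd_basis dX yX a `*` pd_basis dZ yZ b `<=` A).
  rewrite (_ : [set _ | _] = setT) ?setIT; last by apply/seteqP; split.
  apply: measurableI.
    exact: (mb X f _ mf (pd_basis_open dXP a)).
  exact: (mb Z g _ mg (pd_basis_open dZP b)).
by rewrite (_ : [set _ | _] = set0) ?setI0//; apply/seteqP; split.
Qed.

Lemma near_continuous_ereal (X : topologicalType) (h : X -> \bar R) p (e : R) :
  continuous h -> h p \is a fin_num -> 0 < e ->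
  \forall q \near p, (h p - e%:E < h q < h p + e%:E)%E.
Proof.
move=> ch hp e0.
have lo : (h p - e%:E < h p)%E by rewrite -(fineK hp) -EFinB lte_fin; lra.
have hi : (h p < h p + e%:E)%E by rewrite -(fineK hp) -EFinD lte_fin; lra.
have near_lo : \forall q \near p, (h p - e%:E < h q)%E := ch p _ (open_ereal_gt' lo).
have near_hi : \forall q \near p, (h q < h p + e%:E)%E := ch p _ (open_ereal_lt' hi).
by apply: filterS2 near_lo near_hi => q -> ->.
Qed.

End borel_functions.

Section countable_pieces.
Local Open Scope ereal_scope.
Context d (T : measurableType d) (R : realType).
Variable m : {finite_measure set T -> \bar R}.
Variable G : nat -> set T.
Hypotheses (mG : forall n, measurable (G n)) (tG : trivIset setT G).

Lemma measure_pieces A : m (~` \bigcup_n G n) = 0 -> measurable A ->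
  m A = \sum_(n <oo) m (A `&` G n).
Proof.
move=> G0 mA; have mUG : measurable (\bigcup_n G n) by exact: bigcup_measurable.
have -> : m A = m (A `\` \bigcup_n G n) + m (A `&` \bigcup_n G n) by exact: measureDI.
rewrite (subset_measure0 _ (measurableC mUG) _ G0) ?add0e; last 2 first.
- exact: measurableD.
- by move=> x [].
rewrite setI_bigcupr measure_semi_bigcup//.
- by move=> n; exact: measurableI.
- by apply: trivIset_setIl.
- by apply: bigcup_measurable => n _; exact: measurableI.
Qed.

Lemma measure_pieces_full : \sum_(n <oo) m (G n) = m setT ->
  m (~` \bigcup_n G n) = 0.
Proof.
move=> GT; have mUG : measurable (\bigcup_n G n) by exact: bigcup_measurable.
have fT : m setT \is a fin_num by rewrite fin_num_measure.
have mE : m setT = m (~` \bigcup_n G n) + m (\bigcup_n G n).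
  rewrite -(setTD (\bigcup_n G n)) -[X in _ + m X]setTI; exact: measureDI.
have GE : m (\bigcup_n G n) = m setT by rewrite -GT measure_semi_bigcup.
rewrite GE in mE; have := subee fT.
by rewrite [X in X - _]mE addeK.
Qed.

Lemma integral_pieces (h : T -> \bar R) : m (~` \bigcup_n G n) = 0 ->
  measurable_fun setT h -> (forall x, 0 <= h x) ->
  \int[m]_x h x = \sum_(n <oo) \int[m]_(x in G n) h x.
Proof.
move=> G0 mh h0; have mUG : measurable (\bigcup_n G n) by exact: bigcup_measurable.
rewrite (ge0_negligible_integral _ _ _ _ G0)//; last exact: measurableC.
rewrite setTD setCK ge0_integral_bigcup//.
exact: measurable_funTS.
Qed.

End countable_pieces.

(** * Approximating a coupling by a map *)

Section monge_approximation.
Local Open Scope ereal_scope.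
Context (R : realType) (X Z : ptopologicalType).
Context (dX : X -> X -> R) (yX : nat -> X) (dZ : Z -> Z -> R) (yZ : nat -> Z).
Hypotheses (dXP : polish_distance dX yX) (dZP : polish_distance dZ yZ).

(** On a rectangle where [h] oscillates by at most [e], moving the coupling around
    costs at most [e] per unit of mass. The rectangles with this property cover the
    set where [h] is finite, hence [gamma]-almost everything; the first marginals of
    [gamma] on disjoint pieces [C n] of them are the summands of [m] to which the
    selection lemma applies. *)
Theorem monge_approximation (m : {finite_measure set (borel X) -> \bar R})
    (gamma : {finite_measure set (borel (X * Z)%type) -> \bar R})
    (h : X * Z -> \bar R) (e : R) :
  diffuse m -> (forall A : set (borel X), measurable A -> m A = gamma (fst @^-1` A)) ->
  continuous h -> (forall p, 0 <= h p) -> \int[gamma]_p h p < +oo -> (0 < e)%R ->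
  exists S : borel X -> borel Z, [/\ measurable_fun setT S,
    forall B : set (borel Z), measurable B -> m (S @^-1` B) = gamma (snd @^-1` B) &
    \int[m]_x h (x, S x) <= \int[gamma]_p h p + e%:E * gamma setT].
Proof.
move=> mdiff mgamma ch h0 hfin e0.
have mh : measurable_fun setT (h : borel (X * Z)%type -> \bar R).
  exact: continuous_borel_ereal.
have mfst := @measurable_borel_fst X Z; have msnd := @measurable_borel_snd X Z.
have mfstA (A : set (borel X)) : measurable A ->
    measurable ((fst : borel (X * Z)%type -> borel X) @^-1` A).
  by move=> mA; rewrite -[X in measurable X]setTI; exact: mfst.
have msndB (B : set (borel Z)) : measurable B ->
    measurable ((snd : borel (X * Z)%type -> borel Z) @^-1` B).
  by move=> mB; rewrite -[X in measurable X]setTI; exact: msnd.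
have mV := diffuse_along_basis dXP mdiff.
pose good (U : set X) (V : set Z) := forall p q, (U `*` V) p -> (U `*` V) q ->
  h p <= h q + e%:E.
pose P n : set (borel X) := if (unpickle n : option (nat * nat)) is Some (a, b) then pd_basis dX yX a else set0.
pose Q n : set (borel Z) := if (unpickle n : option (nat * nat)) is Some (a, b) then
  (if pselect (good (pd_basis dX yX a) (pd_basis dZ yZ b)) then pd_basis dZ yZ b
   else set0) else set0.
have mP n : measurable (P n).
  rewrite /P; case: unpickle => [[a b]|//].
  by apply: open_borel; exact: (pd_basis_open dXP).
have mQ n : measurable (Q n).
  rewrite /Q; case: unpickle => [[a b]|//]; case: pselect => ? //=.
  by apply: open_borel; exact: (pd_basis_open dZP).
have goodPQ n : good (P n) (Q n).
  rewrite /P /Q; case: unpickle => [[a b]|p q []//].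
  by case: pselect => [//|? p q /= [_ []]].
pose R0 n : set (borel (X * Z)%type) := fst @^-1` (P n) `&` snd @^-1` (Q n).
have mR0 n : measurable (R0 n).
  by apply: measurableI; [exact: mfstA|exact: msndB].
pose C := seqDU R0.
have mC n : measurable (C n).
  by apply: measurableD => //; exact: bigsetU_measurable.
have CR0 n : C n `<=` R0 n by move=> p [].
have tC : trivIset setT C by exact: trivIset_seqDU.
have cover p : h p \is a fin_num -> (\bigcup_n C n) p.
  move=> hp; rewrite -seqDU_bigcup_eq.
  have e20 : (0 < e / 2)%R by rewrite divr_gt0.
  have := near_continuous_ereal ch hp e20.
  case=> -[U V] [/= /(pd_basisP dXP)[a [pa aU]] /(pd_basisP dZP)[b [pb bV]]] UV.
  have gab : good (pd_basis dX yX a) (pd_basis dZ yZ b).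
    move=> q r [/aU qU /bV qV] [/aU rU /bV rV].
    have /andP[_ hq] : h p - (e / 2)%:E < h q < h p + (e / 2)%:E by exact: UV.
    have /andP[hr _] : h p - (e / 2)%:E < h r < h p + (e / 2)%:E by exact: UV.
    apply/ltW/(lt_le_trans hq).
    rewrite lteBlDr// in hr; apply/ltW; apply: (@le_lt_trans _ _ (h p + (e/2)%:E)) => //.
    rewrite [in ltRHS](splitr e) EFinD addeA lteD2rE//.
  exists (pickle (a, b)) => //; rewrite /R0 /P /Q /= pickleK.
  by split => //=; case: pselect.
have C0 : gamma (~` \bigcup_n C n) = 0.
  have [|N [mN N0 hN]] := @integrable_ae _ _ _ gamma setT measurableT h.
    apply/integrableP; split => //; under eq_integral do rewrite gee0_abs//.
    exact: hfin.
  apply: (subset_measure0 _ mN _ N0).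
    by apply: measurableC; exact: bigcup_measurable.
  by move=> p /= Cp; apply: hN => /= /(_ I) /cover.
have /choice[lam hlam] n : exists l : {finite_measure set (borel X) -> \bar R},
    forall A, l A = gamma (fst @^-1` A `&` C n).
  exact: (@exists_image_measure _ _ _ _ _ (mrestr gamma (mC n)) _ mfst).
have /choice[rho hrho] n : exists l : {finite_measure set (borel Z) -> \bar R},
    forall A, l A = gamma (snd @^-1` A `&` C n).
  exact: (@exists_image_measure _ _ _ _ _ (mrestr gamma (mC n)) _ msnd).
have [||E [mE tE EP Elam]] := @diffuse_selection _ _ _ m _ mV
    (fun n => lam n : {measure set _ -> \bar R}) P mP.
- move=> n; apply: etrans (hlam n _) _.
  rewrite (_ : _ `&` _ = set0) ?measure0// -subset0.
  by move=> p [/= Pp /CR0[]].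
- move=> A mA; rewrite mgamma// (measure_pieces mC tC C0 (mfstA _ mA)).
  by apply: eq_eseriesr => n _; apply/esym; exact: hlam.
have EC n : m (E n) = gamma (C n).
  by rewrite Elam; apply: etrans (hlam n _) _; rewrite preimage_setT setTI.
have /choice[f hf] n : exists f : borel X -> borel Z, measurable_fun setT f /\
    forall B : set (borel Z), measurable B -> m (f @^-1` B `&` E n) = rho n B.
  have [||f [mf fB]] := @diffuse_transport _ (borel X) R Z (mrestr m (mE n)) (pd_basis dX yX)
     dZ yZ (rho n) _ dZP.
  - by apply: diffuse_along_le mV => A mA; exact: measureIl.
  - by rewrite /= /mrestr setTI EC hrho preimage_setT setTI.
  - by exists f.
have mf n : measurable_fun setT (f n) by have [] := hf n.
have mfB n (B : set (borel Z)) : measurable B -> measurable (f n @^-1` B).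
  by move=> mB; rewrite -[X in measurable X]setTI; exact: mf.
(* [f n] takes values in [Q n] almost everywhere only: the exceptional points are
   removed, because outside the rectangle the cost is not controlled. *)
pose G n := E n `&` f n @^-1` Q n.
have mG n : measurable (G n) by apply: measurableI => //; exact: mfB.
have tG : trivIset setT G.
  by apply: trivIset_setIr.
have GB n (B : set (borel Z)) : measurable B -> m (f n @^-1` B `&` G n) = rho n B.
  move=> mB; have -> : f n @^-1` B `&` G n = f n @^-1` (B `&` Q n) `&` E n.
    by rewrite /G preimage_setI setICA setIC -!setIA; congr (_ `&` _); rewrite setIC.
  have [_ ->] := hf n; last exact: measurableI.
  rewrite !hrho; congr (gamma _); apply/seteqP; split=> p /= [].
    by move=> [].
  by move=> Bp Cp; split => //; split => //; have [] := CR0 _ _ Cp.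
have GC n : m (G n) = gamma (C n).
  by rewrite -[G n]setTI -(preimage_setT (f n)) GB// hrho preimage_setT setTI.
have G0 : m (~` \bigcup_n G n) = 0.
  apply: measure_pieces_full => //.
  rewrite mgamma// preimage_setT (measure_pieces mC tC C0 measurableT).
  by apply: eq_eseriesr => n _; rewrite setTI GC.
pose S x := f (first_index G x) x.
have SG n x : G n x -> S x = f n x.
  move=> Gx; have [Gfx _] := first_indexP Gx; rewrite /S.
  by rewrite (tG (first_index G x) n I I)//; exists x.
have mS : measurable_fun setT S.
  move=> _ B mB; rewrite setTI.
  have -> : S @^-1` B = \bigcup_n (first_index G @^-1` [set n] `&` f n @^-1` B).
    apply/seteqP; split=> x /=; first by exists (first_index G x).
    by move=> [n _ [/= <-]].
  apply: bigcup_measurable => n _; apply: measurableI; last exact: mfB.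
  exact: measurable_first_index.
have SB (B : set (borel Z)) : measurable B -> m (S @^-1` B) = gamma (snd @^-1` B).
  move=> mB; rewrite (measure_pieces mG tG G0); last first.
    by rewrite -[X in measurable X]setTI; exact: mS.
  rewrite (measure_pieces mC tC C0 (msndB _ mB)).
  apply: eq_eseriesr => n _; rewrite -hrho -GB//; congr (m _).
  by apply/seteqP; split=> x [/= + Gx]; rewrite (SG n).
have mhS : measurable_fun setT (fun x : borel X => h (x, S x)).
  apply: (measurableT_comp mh (f := h : borel (X * Z)%type -> \bar R)
    (g := (fun x : borel X => (x, S x) : borel (X * Z)%type))).
  exact: (borel_pair dXP dZP (@measurable_id _ _ _) mS).
exists S; split => //.
rewrite (integral_pieces mG tG G0 mhS)//.
rewrite (integral_pieces mC tC C0 mh)//.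
rewrite (measure_pieces mC tC C0 measurableT) -nneseriesZl//.
rewrite -nneseriesD//; last 2 first.
- by move=> n _ _; exact: integral_ge0.
- by move=> n _ _; rewrite mule_ge0// lee_fin ltW.
apply: lee_nneseries => [n _ _|n _]; first exact: integral_ge0.
rewrite setTI.
(* The infimum is [+oo] if [C n] is empty, harmlessly: [G n] is null then. *)
pose c := ereal_inf (h @` C n).
have c0 : 0 <= c by apply: le_ereal_inf_tmp => _ [p _ <-].
have hGc x : G n x -> h (x, S x) <= c + e%:E.
  move=> Gx; rewrite -leeBlDr//; apply: le_ereal_inf_tmp => _ [p Cp <-].
  rewrite leeBlDr//; apply: (goodPQ n); last exact: CR0.
  by case: (Gx) => Ex Qx; split; [exact: EP|rewrite /= (SG n)].
have mhC : measurable_fun (C n) h by exact: measurable_funTS.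
apply: (@le_trans _ _ (\int[m]_(x in G n) (c + e%:E))).
  apply: ge0_le_integral => //; first exact: measurable_funTS.
have -> : \int[m]_(x in G n) (c + e%:E) = \int[gamma]_(x in C n) (c + e%:E).
  by rewrite !integral_cst//; congr (_ * _); exact: GC.
apply: (@le_trans _ _ (\int[gamma]_(p in C n) (h p + e%:E))).
  apply: ge0_le_integral => //.
  - by move=> p _; rewrite adde_ge0// lee_fin ltW.
  - by apply: emeasurable_funD.
  - by move=> p Cp; rewrite leeD2r//; apply: ereal_inf_lbound; exists p.
rewrite ge0_integralD//; last by move=> *; rewrite lee_fin ltW.
by rewrite integral_cst.
Qed.

End monge_approximation.

(** * Polish distances on products and half-lines *)

Section geometric_sequences.
Context (R : realType) (Z : Type) (d : Z -> Z -> R) (u : nat -> Z).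
Hypothesis d_refl : forall x, d x x = 0.
Hypothesis d_triangle : forall x y z, d x z <= d x y + d y z.
Hypothesis u_step : forall n, d (u n) (u n.+1) < 2 ^- n.

Lemma geometric_steps n k : d (u n) (u (n + k)%N) <= 2 * 2 ^- n - 2 * 2 ^- (n + k).
Proof.
elim: k => [|k ih]; first by rewrite addn0 d_refl subrr.
have := d_triangle (u n) (u (n + k)%N) (u (n + k.+1)%N).
have := u_step (n + k)%N; rewrite addnS; have := exp2NS R (n + k); lra.
Qed.

Lemma geometric_limit z : (forall e, 0 < e -> exists n0, forall n, (n0 <= n)%N ->
  d (u n) z < e) -> forall n, d (u n) z <= 2 * 2 ^- n.
Proof.
move=> uz n; apply/ler_addgt0Pr => e /uz[n0 hn0].
have := hn0 (n + n0)%N (leq_addl _ _); have := geometric_steps n n0.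
have := d_triangle (u n) (u (n + n0)%N) z; have := exp2N_gt0 R (n + n0); lra.
Qed.

End geometric_sequences.

Section polish_examples.
Context (R : realType).

Lemma polish_space_distance (X : ptopologicalType) : polish_space R X ->
  exists (d : X -> X -> R) y, polish_distance d y.
Proof.
move=> [[D /countable_injP[e einj] denseD] [M [f [g [fK gK cf cg complete]]]]].
pose d (x z : X) : R := mdist (f x) (f z).
have /choice[y yP] n : exists y : X, forall x, D x -> e x = n -> y = x.
  have [[x [Dx ex]]|h] := pselect (exists x, D x /\ e x = n).
    by exists x => z Dz ez; apply: einj; rewrite ?inE// ez.
  by exists point => x Dx ex; exfalso; apply: h; exists x.
have nbhsd x A : nbhs x A <-> exists2 e, 0 < e & forall z, d x z < e -> A z.
  split=> [nA|[r r0 rA]].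
    have : nbhs (f x) (g @^-1` A) by apply: cg; rewrite fK.
    move=> /nbhs_ballP[r r0 hr]; exists r => // z dz; rewrite -(fK z); apply: hr.
    by rewrite ballEmdist.
  have fx : nbhs (f x) (ball (f x) r) by apply/nbhs_ballP; exists r.
  have fx' : nbhs x (f @^-1` ball (f x) r) := cf x _ fx.
  by apply: filterS fx' => z /=; rewrite ballEmdist; exact: rA.
have d_refl x : d x x = 0 by exact: mdistxx.
have d_tri x z w : d x w <= d x z + d z w by exact: metric_triangle.
exists d, y; split => //.
- by move=> x z /mdist_positivity /(congr1 g); rewrite !fK.
- by move=> x z; exact: metric_sym.
- move=> x r r0; have [] := denseD (interior [set z | d x z < r]).
  + by exists x; apply/nbhsd; exists r.
  + exact: open_interior.
  + move=> z [/interior_subset/= dz Dz]; exists (e z).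
    by rewrite (yP (e z) z).
- move=> u u_step.
  have cau : cauchy ((f \o u) @ \oo).
    apply/cauchyP => r r0; have [n nr] : exists n, 2 ^- n < r / 2.
      by apply: exp2N_lt; rewrite divr_gt0.
    exists (f (u n)); exists n => // k /= nk; rewrite ballEmdist /=.
    have := geometric_steps d_refl d_tri u_step n (k - n); rewrite subnKC// /d.
    have := exp2N_gt0 R k; lra.
  have [z uz] := complete _ _ cau; exists (g z).
  apply: geometric_limit => // r r0.
  have /uz[n0 _ hn0] : nbhs z (ball z r) by apply/nbhs_ballP; exists r.
  exists n0 => n nn0; have := hn0 n nn0; rewrite /= ballEmdist/= /d gK.
  by rewrite metric_sym.
Qed.

Lemma polish_distance_prod (X Z : ptopologicalType)
    (dX : X -> X -> R) yX (dZ : Z -> Z -> R) yZ :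
  polish_distance dX yX -> polish_distance dZ yZ ->
  exists (d : (X * Z)%type -> (X * Z)%type -> R) y, polish_distance d y.
Proof.
move=> XP ZP.
pose d (p q : X * Z) := Num.max (dX p.1 q.1) (dZ p.2 q.2).
pose y n : X * Z := if (unpickle n : option (nat * nat)) is Some (a, b) then
  (yX a, yZ b) else point.
have d_refl x : d x x = 0 by rewrite /d (pd_refl XP) (pd_refl ZP) maxxx.
have d_tri x z w : d x w <= d x z + d z w.
  rewrite /d ge_max; have := pd_triangle XP x.1 z.1 w.1.
  have := pd_triangle ZP x.2 z.2 w.2.
  have : dX x.1 z.1 <= d x z by rewrite /d le_max lexx.
  have : dZ x.2 z.2 <= d x z by rewrite /d le_max lexx orbT.
  have : dX z.1 w.1 <= d z w by rewrite /d le_max lexx.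
  have : dZ z.2 w.2 <= d z w by rewrite /d le_max lexx orbT.
  rewrite /d => *; apply/andP; split; lra.
exists d, y; split => //.
- move=> [x1 x2] [z1 z2]; rewrite /d /= => xz.
  congr pair; [apply: (pd_separated XP)|apply: (pd_separated ZP)];
    apply/eqP; rewrite eq_le ?(pd_ge0 XP) ?(pd_ge0 ZP) andbT -xz le_max lexx//.
  by rewrite orbT.
- by move=> x z; rewrite /d (pd_sym XP) (pd_sym ZP).
- move=> [x z] A; split=> [[[B C] [/= /(pd_nbhs XP)[a a0 aB] /(pd_nbhs ZP)[c c0 cC]] BC]|].
    exists (Num.min a c); first by rewrite lt_min a0.
    move=> [x' z']; rewrite /d /= gt_max !lt_min => /andP[/andP[xa _] /andP[_ zc]].
    by apply: BC; split; [exact: aB|exact: cC].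
  move=> [r r0 rA]; exists ([set x' | dX x x' < r], [set z' | dZ z z' < r]) => /=.
    by split; [apply/(pd_nbhs XP)|apply/(pd_nbhs ZP)]; exists r.
  by move=> [x' z'] [/= xr zr]; apply: rA; rewrite /d /= gt_max xr.
- move=> [x z] r r0; have [a xa] := pd_dense XP x r0; have [b zb] := pd_dense ZP z r0.
  by exists (pickle (a, b)); rewrite /y pickleK /d /= gt_max xa.
- move=> u u_step.
  have [|z1 h1] := pd_complete XP (u := fst \o u).
    by move=> n; apply: le_lt_trans (u_step n); rewrite /d le_max lexx.
  have [|z2 h2] := pd_complete ZP (u := snd \o u).
    by move=> n; apply: le_lt_trans (u_step n); rewrite /d le_max lexx orbT.
  by exists (z1, z2) => n; rewrite /d ge_max; apply/andP; split; [exact: h1|exact: h2].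
Qed.

Lemma nbhs_nonneg (r : {nonneg R}) (A : set {nonneg R}) :
  nbhs r A <-> exists2 e, 0 < e & forall s : {nonneg R}, `|r%:num - s%:num| < e -> A s.
Proof.
split=> [|[e e0 eA]].
  move=> [B [[C oC CB] Br BA]]; rewrite -CB /= in Br.
  have : nbhs (r%:num) C by apply: open_nbhs_nbhs.
  move=> /nbhs_ballP[e e0 eC]; exists e => // s rs; apply: BA.
  by rewrite -CB /=; exact: eC.
exists [set s : {nonneg R} | ball (r%:num) e s%:num]; split.
- by exists (ball r%:num e) => //; exact: ball_open.
- exact: ballxx.
- by move=> s; exact: eA.
Qed.

Lemma polish_distance_nonneg :
  exists (d : {nonneg R} -> {nonneg R} -> R) y, polish_distance d y.
Proof.
pose d (r s : {nonneg R}) : R := `|r%:num - s%:num|.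
pose y n : {nonneg R} :=
  NngNum (normr_ge0 (ratr (odflt 0 (unpickle n : option rat)) : R)).
have d_refl x : d x x = 0 by rewrite /d subrr normr0.
have d_tri x z w : d x w <= d x z + d z w by rewrite /d ler_distD.
exists d, y; split => //.
- by move=> r s /normr0_eq0/subr0_eq rs; apply/val_inj.
- by move=> r s; rewrite /d distrC.
- exact: nbhs_nonneg.
- move=> r e e0; have /rat_in_itvoo[q] : r%:num < r%:num + e by rewrite ltrDl.
  rewrite in_itv /= => /andP[rq qe]; exists (pickle q); rewrite /y pickleK /d /=.
  have q0 : 0 <= ratr q :> R by apply: ltW; apply: le_lt_trans rq.
  by rewrite (ger0_norm q0) ltr0_norm ?subr_lt0// opprB ltrBlDl.
- move=> u u_step; pose v n := (u n)%:num.
  have cau : cauchy (v @ \oo).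
    apply/cauchyP => r r0; have [n nr] : exists n, 2 ^- n < r / 2.
      by apply: exp2N_lt; rewrite divr_gt0.
    exists (v n); exists n => // k /= nk; rewrite /ball /=.
    have := geometric_steps d_refl d_tri u_step n (k - n); rewrite subnKC// /d.
    have := exp2N_gt0 R k; rewrite /v; lra.
  have /cvg_ex[l vl] : cvg (v @ \oo) by apply/cauchy_cvgP.
  have l0 : 0 <= l.
    rewrite -(cvg_lim _ vl)//; apply: limr_ge; first by apply/cvg_ex; exists l.
    by apply: nearW => n; rewrite /v.
  exists (NngNum l0); apply: geometric_limit => // r r0.
  have /vl[n0 _ hn0] : nbhs l (ball l r) by apply/nbhs_ballP; exists r.
  by exists n0 => n nn0; have := hn0 n nn0; rewrite /= /d /ball /= distrC.
Qed.

End polish_examples.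

(** * Tightness and inner regularity *)

Section tightness.
Local Open Scope ereal_scope.

Lemma measure_exhaustion d (T : measurableType d) (R : realType)
    (m : {finite_measure set T -> \bar R}) (A : set T) (F : nat -> set T) (e : R) :
  (forall n, measurable (F n)) -> measurable A -> nondecreasing_seq F ->
  A `<=` \bigcup_n F n -> (0 < e)%R -> exists n, m (A `\` F n) <= e%:E.
Proof.
move=> mF mA ndF AF e0.
have mAF n : measurable (A `\` F n) by exact: measurableD.
have cap0 : \bigcap_n (A `\` F n) = set0.
  rewrite -subset0 => x Ax; have [/AF[n _ Fnx] _] := Ax 0%N I.
  by have [_] := Ax n I.
have : m (A `\` F n) @[n --> \oo] --> m (\bigcap_n (A `\` F n)).
  apply: nonincreasing_cvg_mu => //.
  - by rewrite -ge0_fin_numE// fin_num_measure.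
  - by rewrite cap0.
  - by move=> i j ij; apply/subsetPset; apply: setDS; exact/subsetPset/ndF.
rewrite cap0 measure0 => cvg0.
have near0 : ereal_nbhs 0 (fun u => u < e%:E) by apply: open_ereal_lt'; rewrite lte_fin.
have [n _ hn] := cvg0 _ near0.
by exists n; exact/ltW/hn/leqnn.
Qed.

Lemma measure_le_geometric d (T : measurableType d) (R : realType)
    (m : {measure set T -> \bar R}) (A : set T) (F : nat -> set T) (e : R) :
  (forall n, measurable (F n)) -> measurable A -> A `<=` \bigcup_n F n ->
  (0 < e)%R -> (forall n, m (F n) <= (e / (2 ^ n.+1)%:R)%:E) -> m A <= e%:E.
Proof.
move=> mF mA AF e0 Fe.
have := @measure_sigma_subadditive _ _ _ m _ _ mF mA AF.
move=> /le_trans; apply; apply: le_trans (epsilon_trick0 xpredT (ltW e0)).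
by apply: lee_nneseries => [n _ _|n _].
Qed.

Context (R : realType) (Z : ptopologicalType) (d : Z -> Z -> R) (y : nat -> Z).
Hypothesis dP : polish_distance d y.

Lemma pd_closed_ball x e : closed [set z | (d x z <= e)%R].
Proof.
rewrite -[X in closed X]setCK closedC; have -> : ~` [set z | (d x z <= e)%R] = [set z | (e < d x z)%R].
  by apply/seteqP; split=> z /=; rewrite ltNge => /negP.
rewrite openE => z /= ez; apply/(pd_nbhs dP); exists (d x z - e)%R; first by rewrite subr_gt0.
by move=> w zw /=; have := pd_triangle dP x w z; rewrite (pd_sym dP w z); lra.
Qed.

Lemma ultra_bigsetU (T : Type) (F : set_system T) (C : nat -> set T) N :
  UltraFilter F -> F (\big[setU/set0]_(k < N) C k) -> exists k, F (C k).
Proof.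
move=> FU; elim: N => [|N ih]; first by rewrite big_ord0 => /filter_not_empty.
rewrite big_ord_recr /= => FCN.
have [FC|FC] := in_ultra_setVsetC (C N) FU; first by exists N.
by apply: ih; apply: filterS2 FCN FC => x [].
Qed.

(** Total boundedness and completeness give compactness: an ultrafilter selects
    one small ball at every scale, and the centres form a geometric sequence. *)
Lemma pd_compact (N : nat -> nat) (K : set Z) : closed K ->
  (forall n, K `<=` \big[setU/set0]_(k < N n) [set z | (d (y k) z <= 2 ^- n.+1)%R]) ->
  compact K.
Proof.
move=> cK Kballs; rewrite compact_ultra => F FU FK.
have /choice[k hk] n : exists k, F [set z | (d (y k) z <= 2 ^- n.+1)%R].
  by apply: (@ultra_bigsetU _ _ _ (N n) FU); apply: filterS FK; exact: Kballs.
have [|z yz] := pd_complete dP (u := y \o k).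
  move=> n; have [z [/= z1 z2]] := filter_ex (filterI (hk n) (hk n.+1)).
  have := pd_triangle dP (y (k n)) z (y (k n.+1)); rewrite (pd_sym dP z).
  have := exp2NS R n; have := exp2NS R n.+1; have := exp2N_gt0 R n.+2; lra.
have Fz : F --> z.
  move=> A /(pd_nbhs dP)[e e0 eA].
  have [n ne] : exists n, (2 ^- n < e / 3)%R by apply: exp2N_lt; rewrite divr_gt0.
  apply: filterS (hk n) => w /= hw; apply: eA.
  have := pd_triangle dP z (y (k n)) w; rewrite (pd_sym dP z (y (k n))).
  have := yz n; have := exp2NS R n; have := exp2N_gt0 R n.+1; rewrite /=; lra.
exists z; split => //; apply: contrapT => nKz.
have : nbhs z (~` K) by apply: open_nbhs_nbhs; split => //; exact: closed_openC.
move=> /Fz FnK; have [w []] := filter_ex (filterI FK FnK); exact.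
Qed.

Context (m : {finite_measure set (borel Z) -> \bar R}).

Lemma closed_borel (A : set Z) : closed A -> measurable (A : set (borel Z)).
Proof.
by move=> cA; rewrite -(setCK A); apply: measurableC; apply: open_borel; exact: closed_openC.
Qed.

(** Finitely many balls of a given scale carry all but a small part of the mass;
    the parts left out at all scales add up to a geometric series. *)
Lemma finite_measure_tight (e : R) : (0 < e)%R ->
  exists K : set (borel Z), [/\ compact (K : set Z), closed (K : set Z) & m (~` K) <= e%:E].
Proof.
move=> e0; pose C n k : set (borel Z) := [set z | (d (y k) z <= 2 ^- n.+1)%R].
pose B n N : set (borel Z) := \big[setU/set0]_(k < N) C n k.
have cC n k : closed (C n k : set Z) by exact: pd_closed_ball.
have cB n N : closed (B n N : set Z).
  by apply: (@big_ind _ (fun A : set Z => closed A)) => //; [exact: closed0|exact: closedU].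
have e'0 n : (0 < e / (2 ^ n.+1)%:R)%R by rewrite divr_gt0// ltr0n expn_gt0.
have /choice[N hN] n : exists N, m (setT `\` B n N) <= (e / (2 ^ n.+1)%:R)%:E.
  apply: measure_exhaustion => //.
  - by move=> N; exact: closed_borel.
  - by move=> i j ij; apply/subsetPset; exact: subset_bigsetU.
  - move=> z _; have [k zk] := pd_dense dP z (exp2N_gt0 R n.+1).
    exists k.+1 => //; rewrite /B big_ord_recr /=; right.
    by rewrite /C /= (pd_sym dP) ltW.
have cK : closed (\bigcap_n B n (N n) : set Z) by apply: closed_bigI => n _; exact: cB.
exists (\bigcap_n B n (N n)); split => //.
  by apply: (@pd_compact N) => // n z; apply.
apply: (@measure_le_geometric _ _ _ m _ (fun n => setT `\` B n (N n))) => //.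
- by move=> n; apply: measurableD => //; exact: closed_borel.
- by apply: measurableC; exact: closed_borel.
- by rewrite setC_bigcap => z [n _ nB]; exists n.
Qed.

Let inner (A : set (borel Z)) := forall e : R, (0 < e)%R -> exists K : set (borel Z),
  [/\ compact (K : set Z), closed (K : set Z), K `<=` A & m (A `\` K) <= e%:E].

(** The sets that are approximated by compact sets together with their complement
    form a sigma-algebra: compact sets are stable under finite unions and countable
    intersections. It contains the open sets, which are countable unions of closed
    sets, and closed sets are handled by tightness. *)
Lemma borel_inner_compact (A : set (borel Z)) : measurable A -> inner A.
Proof.
move: A; suff : measurable `<=` [set A : set (borel Z) | [/\ measurable A, inner A & inner (~` A)]].
  by move=> h A /h[].
have e2 (e : R) n : (0 < e)%R -> (0 < e / (2 ^ n.+1)%:R)%R.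
  by move=> e0; rewrite divr_gt0// ltr0n expn_gt0.
have inner_closed (A : set Z) : closed A -> inner A.
  move=> cA e e0; have [K [coK cK mK]] := finite_measure_tight e0.
  have cAK : closed (A `&` K) by exact: closedI.
  exists (A `&` K); split => //; first by rewrite setIC; exact: compact_closedI.
  apply: le_trans mK; rewrite le_measure ?inE//.
  + by apply: measurableD; exact: closed_borel.
  + by apply: measurableC; exact: closed_borel.
  + by move=> z [Az nAK] Kz; apply: nAK.
have inner_bigcup (A : nat -> set (borel Z)) : (forall n, measurable (A n)) ->
    (forall n, inner (A n)) -> inner (\bigcup_n A n).
  move=> mA iA e e0; have e20 : (0 < e / 2)%R by rewrite divr_gt0.
  have /choice[K hK] n := iA n _ (e2 _ n e20).
  have coK n : compact (K n : set Z) by have [] := hK n.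
  have cK n : closed (K n : set Z) by have [] := hK n.
  have KA n : K n `<=` A n by have [] := hK n.
  pose B N : set (borel Z) := \big[setU/set0]_(n < N) K n.
  have cB N : closed (B N : set Z).
    by apply: (@big_ind _ (fun A : set Z => closed A)) => //; [exact: closed0|exact: closedU].
  have mUA : measurable (\bigcup_n A n) by exact: bigcup_measurable.
  have mK n : measurable (K n) by exact: closed_borel.
  have mUK : measurable (\bigcup_n K n) by exact: bigcup_measurable.
  have mB N : measurable (B N) by exact: closed_borel.
  have [N hN] : exists N, m ((\bigcup_n K n) `\` B N) <= (e / 2)%:E.
    apply: measure_exhaustion => //.
    - by move=> i j ij; apply/subsetPset; exact: subset_bigsetU.
    - move=> z [n _ Kz]; exists n.+1 => //; rewrite /B big_ord_recr /=; by right.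
  exists (B N); split => //.
  + apply: (@big_ind _ (fun A : set Z => compact A)) => //; first exact: compact0.
    by move=> ? ?; exact: compactU.
  + by rewrite /B -(@bigcup_mkord _ N K) => z [n _ /KA]; exists n.
  have mUAK : m (\bigcup_n A n `\` \bigcup_n K n) <= (e / 2)%:E.
    apply: (@measure_le_geometric _ _ _ m _ (fun n => A n `\` K n)) => //.
    - by move=> n; exact: measurableD.
    - exact: measurableD.
    - by move=> z [[n _ An] nK]; exists n => //; split => // Kn; apply: nK; exists n.
    - by move=> n; have [] := hK n.
  rewrite [e]splitr EFinD; apply: le_trans (leeD mUAK hN).
  apply: (@le_trans _ _ (m ((\bigcup_n A n `\` \bigcup_n K n) `|`
      (\bigcup_n K n `\` B N)))); last by apply: measureU2; exact: measurableD.
  rewrite le_measure ?inE//; [exact: measurableD|by apply: measurableU; exact: measurableD|].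
  move=> z [Az nB]; have [Kz|nKz] := pselect ((\bigcup_n K n) z); [by right|by left].
have inner_bigcap (A : nat -> set (borel Z)) : (forall n, measurable (A n)) ->
    (forall n, inner (A n)) -> inner (\bigcap_n A n).
  move=> mA iA e e0.
  have /choice[K hK] n := iA n _ (e2 _ n e0).
  have cK n : closed (K n : set Z) by have [] := hK n.
  have cKK : closed (\bigcap_n K n : set Z) by exact: closed_bigI.
  exists (\bigcap_n K n); split => //.
  + rewrite (_ : \bigcap_n K n = K 0%N `&` \bigcap_n K n).
      by apply: compact_closedI => //; have [] := hK 0%N.
    by apply/esym/setIidr => z; apply.
  + by move=> z Kz n _; have [_ _ + _] := hK n; apply; exact: Kz.
  apply: (@measure_le_geometric _ _ _ m _ (fun n => A n `\` K n)) => //.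
  - by move=> n; apply: measurableD => //; exact: closed_borel.
  - by apply: measurableD; [exact: bigcap_measurable|exact: closed_borel].
  - move=> z [Az nK]; apply: contrapT => h; apply: nK => n _; apply: contrapT => nKn.
    by apply: h; exists n => //; split => //; exact: Az.
  - by move=> n; have [] := hK n.
apply: smallest_sub; last first.
  move=> U oU; split; first exact: open_borel.
    pose F n : set (borel Z) := [set z | forall w, ~ U w -> (2 ^- n <= d z w)%R].
    have cF n : closed (F n : set Z).
      rewrite (_ : F n = \bigcap_(w in ~` U) [set z | (2 ^- n <= d z w)%R]).
        apply: closed_bigI => w _; rewrite -[X in closed X]setCK closedC.
        rewrite (_ : ~` _ = [set z | (d w z < 2 ^- n)%R]); first exact: pd_open_ball dP _ _.
        by apply/seteqP; split=> z /=; rewrite (pd_sym dP) ltNge => /negP.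
      by [].
    have -> : U = \bigcup_n F n.
      apply/seteqP; split=> z.
        move=> Uz; have [e e0 eU] := pd_openP dP oU Uz; have [n ne] := exp2N_lt e0.
        exists n => // w nUw; rewrite leNgt; apply/negP => zw; apply: nUw; apply: eU.
        exact: lt_trans ne.
      move=> [n _ Fz]; apply: contrapT => /Fz; rewrite (pd_refl dP).
      by have := exp2N_gt0 R n; lra.
    by apply: inner_bigcup => n; [exact: closed_borel|exact: inner_closed].
  by apply: inner_closed; exact: open_closedC.
split.
- by split=> //; [apply: inner_closed; exact: closed0|rewrite setC0; apply: inner_closed; exact: closedT].
- by move=> A [mA iA iCA]; rewrite setTD; split => //; [exact: measurableC|rewrite setCK].
- move=> A hA; split.
  + by apply: bigcup_measurable => n _; have [] := hA n.
  + by apply: inner_bigcup => n; have [] := hA n.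
  + rewrite setC_bigcup; apply: inner_bigcap => n; have [mA _ iA] := hA n => //.
    exact: measurableC.
Qed.

End tightness.

Section radon_image.
Local Open Scope ereal_scope.

Lemma image_radon (R : realType) (Z W : ptopologicalType) (d : Z -> Z -> R) y
    (m : {finite_measure set (borel Z) -> \bar R})
    (n : {finite_measure set (borel W) -> \bar R}) (f : Z -> W) :
  polish_distance d y -> hausdorff_space W -> continuous f ->
  (forall A : set (borel W), measurable A -> n A = m (f @^-1` A)) -> radon n.
Proof.
move=> dP hW cf nE A mA; apply/eqP; rewrite eq_le; apply/andP; split; last first.
  apply: ge_ereal_sup => _ [K [_ mK KA] <-].
  by rewrite le_measure ?inE.
have mf := continuous_borel cf.
have mfA (B : set (borel W)) : measurable B -> measurable (f @^-1` B : set (borel Z)).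
  by move=> mB; rewrite -[X in measurable X]setTI; exact: mf.
apply/lee_addgt0Pr => e e0.
have [K [coK cK KA mK]] := borel_inner_compact dP m (mfA _ mA) e0.
have cofK : compact (f @` K : set W).
  by apply: continuous_compact => //; exact: continuous_subspaceT.
have mfK : measurable (f @` K : set (borel W)).
  by apply: closed_borel; exact: compact_closed.
have fKA : f @` K `<=` A by move=> _ [z Kz <-]; exact: KA.
apply: (@le_trans _ _ (n (f @` K) + e%:E)); last first.
  by rewrite leeD2r//; apply: ereal_sup_ubound; exists (f @` K).
rewrite (nE _ mA) (nE _ mfK).
have -> : m (f @^-1` A) = m (f @^-1` A `\` K) + m (f @^-1` A `&` K).
  by apply: measureDI; [exact: mfA|exact: closed_borel].
rewrite addeC; apply: leeD => //.
rewrite le_measure ?inE//.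
- by apply: measurableI; [exact: mfA|exact: closed_borel].
- exact: mfA.
- by move=> z [_ Kz]; exists z.
Qed.

End radon_image.

(** * Topology and Borel structure of the cone *)

Section real_valued_borel.
Context (R : realType).

Lemma continuous_borel_real (X : ptopologicalType) (f : X -> R) :
  continuous f -> measurable_fun setT (f : borel X -> R).
Proof.
move=> cf; apply/measurable_EFinP; apply: (@continuous_borel_ereal R X (EFin \o f)).
by move=> x; apply: continuous_comp; [exact: cf|exact: cvg_id].
Qed.

Lemma continuous_num : continuous (fun r : {nonneg R} => r%:num).
Proof. exact: initial_continuous. Qed.

Lemma measurable_nonneg d (T : measurableType d) (f : T -> borel {nonneg R}) :
  measurable_fun setT (fun t => (f t : {nonneg R})%:num) -> measurable_fun setT f.
Proof.
move=> mf; apply: borel_measurable_fun => A [B oB <-].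
rewrite -comp_preimage -[X in measurable X]setTI; apply: mf => //.
exact: open_measurable.
Qed.

Lemma measurable_borel_num :
  measurable_fun setT (fun r : borel {nonneg R} => (r : {nonneg R})%:num).
Proof. exact: continuous_borel_real continuous_num. Qed.

End real_valued_borel.

Section cone_topology.
Context (R : realType) (X : ptopologicalType).
Implicit Types (p q : cone R X).

Lemma cone_pt0 (x y : X) (r s : {nonneg R}) : r%:num = 0 -> s%:num = 0 ->
  cone_pt x r = cone_pt y s.
Proof. by move=> r0 s0; apply/cone_pt_eqP; right. Qed.

(** Away from the vertex the cone has the quotient topology; at the vertex only the
    radius has to be small. *)
Lemma continuous_cone_pt : continuous (fun z : X * {nonneg R} => cone_pt z.1 z.2).
Proof.
move=> [x r] /= A; have [r0|r0] := eqVneq r%:num 0.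
  rewrite (cone_pt0 x x r0 (erefl : (0%:nng : {nonneg R})%:num = 0)) nbhs_cone_vertex.
  move=> [e /= e0 eA].
  have : nbhs r [set s : {nonneg R} | s%:num < e].
    apply/nbhs_nonneg; exists e => // s; rewrite r0 sub0r normrN ger0_norm//.
  move=> re; exists (setT, [set s : {nonneg R} | s%:num < e]).
    by split => //=; exact: filterT.
  by move=> [y s] [_ /= se]; apply: eA; exists y, s.
rewrite nbhs_cone_pt; last by rewrite lt_neqAle eq_sym r0/=.
by move=> [V nV VA]; apply: filterS nV => z Vz; apply: VA; exists z.
Qed.

Lemma continuous_cone_radius : continuous (@cone_radius R X).
Proof.
move=> p A; rewrite -(cone_pt_repr p); move: (repr p) => [x r] /=.
rewrite cone_radiusE => /nbhs_ballP[e /= e0 eA].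
suff : nbhs (cone_pt x r) [set p : cone R X | `|r%:num - cone_radius p| < e].
  by apply: filterS => p' ?; exact: eA.
have [r0|r0] := eqVneq r%:num 0.
  rewrite (cone_pt0 x x r0 (erefl : (0%:nng : {nonneg R})%:num = 0)) nbhs_cone_vertex.
  exists e => // _ [y [s [se ->]]] /=.
  by rewrite cone_radiusE r0 sub0r normrN ger0_norm.
have rpos : 0 < r%:num by rewrite lt_neqAle eq_sym r0/=.
rewrite nbhs_cone_pt//.
exists [set z : X * {nonneg R} | `|r%:num - z.2%:num| < e].
  exists (setT, [set s : {nonneg R} | `|r%:num - s%:num| < e]).
    by split => /=; [exact: filterT|apply/nbhs_nonneg; exists e].
  by move=> [y s] [].
by move=> _ [[y s] /= ys <-]; rewrite cone_radiusE.
Qed.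

Lemma open_cone_over (A : set X) : open A ->
  open [set p : cone R X | 0 < cone_radius p /\ A (cone_base p)].
Proof.
move=> oA; rewrite openE => p; rewrite -(cone_pt_repr p).
move: (repr p) => [x r] /=; rewrite cone_radiusE => -[r0].
rewrite cone_baseE; last by move=> r1; rewrite r1 ltxx in r0.
move=> Ax; rewrite /interior nbhs_cone_pt//.
exists (A `*` [set s : {nonneg R} | 0 < s%:num]).
  exists (A, [set s : {nonneg R} | 0 < s%:num]) => //=; split.
    exact: open_nbhs_nbhs.
  apply/nbhs_nonneg; exists r%:num => // s; rewrite ltr_distlC subrr => /andP[//].
move=> _ [[y s] [/= Ay s0] <-] /=; rewrite cone_radiusE cone_baseE//.
by move=> s1; rewrite s1 ltxx in s0.
Qed.

Lemma cone_hausdorff : hausdorff_space X -> hausdorff_space (cone R X).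
Proof.
move=> hX p q pq.
have rpq : cone_radius p = cone_radius q.
  apply: (@Rhausdorff R) => A B nA nB.
  have [z [Az Bz]] := pq _ _ (continuous_cone_radius nA) (continuous_cone_radius nB).
  by exists (cone_radius z).
rewrite -(cone_pt_repr p) -(cone_pt_repr q).
have [r0|r0] := eqVneq (cone_radius p) 0.
  by apply: cone_pt0 => //; rewrite -/(cone_radius q) -rpq.
have rpos : 0 < cone_radius p by rewrite lt_neqAle eq_sym r0 cone_radius_ge0.
have xpq : (repr p).1 = (repr q).1.
  apply: hX => A B; rewrite !nbhsE => -[A' [oA' Ap] A'A] [B' [oB' Bq] B'B].
  have [z [[_ Az] [_ Bz]]] : [set p : cone R X | 0 < cone_radius p /\ A' (cone_base p)] `&`
      [set p : cone R X | 0 < cone_radius p /\ B' (cone_base p)] !=set0.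
    apply: pq; apply: open_nbhs_nbhs; split => //; try exact: open_cone_over.
    by split => //; rewrite -rpq.
  by exists (cone_base z); split; [exact: A'A|exact: B'B].
apply/cone_pt_eqP; left; split => //; last by apply/eqP.
by apply/val_inj; exact: rpq.
Qed.

(** The base point, with a constant value at the vertex so that it is Borel. *)
Definition cone_base0 (p : cone R X) : X :=
  if cone_radius p == 0 then point else cone_base p.

Lemma measurable_cone_base0 :
  measurable_fun setT (cone_base0 : borel (cone R X) -> borel X).
Proof.
apply: borel_measurable_fun => A oA.
have mr : measurable ([set p | cone_radius p = 0] : set (borel (cone R X))).
  have := continuous_borel_real continuous_cone_radius.
  by move=> /(_ measurableT _ (measurable_set1 0)); rewrite setTI.
rewrite (_ : _ @^-1` _ = [set p | 0 < cone_radius p /\ A (cone_base p)] `|`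
    ([set p | cone_radius p = 0] `&` [set _ | A point])).
  apply: measurableU; first by apply: open_borel; exact: open_cone_over.
  have [Ap|Ap] := pselect (A point).
    by rewrite (_ : [set _ | A point] = setT) ?setIT//; apply/seteqP; split.
  by rewrite (_ : [set _ | A point] = set0) ?setI0//; apply/seteqP; split.
apply/seteqP; split=> p /=; rewrite /cone_base0.
  case: eqP => [p0 Ap|/eqP p0 Ap]; [by right|left; split => //].
  by rewrite lt_neqAle eq_sym p0 cone_radius_ge0.
by move=> [[p0 Ap]|[-> Ap]]; [rewrite gt_eqF|rewrite eqxx].
Qed.

End cone_topology.

Lemma polish_hausdorff (R : realType) (Z : ptopologicalType) (d : Z -> Z -> R) y :
  polish_distance d y -> hausdorff_space Z.
Proof.
move=> dP x z xz; apply: (pd_separated dP); apply/eqP; rewrite eq_le (pd_ge0 dP) andbT.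
apply/ler_addgt0Pr => e e0; rewrite add0r leNgt; apply/negP => exz.
have e2 : 0 < d x z / 2 by rewrite divr_gt0// (lt_trans e0).
have [w [/= xw zw]] := xz [set w | d x w < d x z / 2] [set w | d z w < d x z / 2]
  ltac:(by apply/(pd_nbhs dP); exists (d x z / 2))
  ltac:(by apply/(pd_nbhs dP); exists (d x z / 2)).
by have := pd_triangle dP x w z; rewrite (pd_sym dP w z); lra.
Qed.

Lemma hausdorff_prod (X Z : topologicalType) :
  hausdorff_space X -> hausdorff_space Z -> hausdorff_space (X * Z)%type.
Proof.
move=> hX hZ [x1 z1] [x2 z2] h; congr pair.
- apply: hX => A B nA nB.
  have [[x z] [/= Ax Bx]] := h (fst @^-1` A) (fst @^-1` B) (cvg_fst nA) (cvg_fst nB).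
  by exists x.
- apply: hZ => A B nA nB.
  have [[x z] [/= Ax Bx]] := h (snd @^-1` A) (snd @^-1` B) (cvg_snd nA) (cvg_snd nB).
  by exists z.
Qed.

(** * From transport maps to homogeneous plans *)

Section homogeneous_lift.
Local Open Scope ereal_scope.
Context (R : realType) (X1 X2 : ptopologicalType).
Context (d1 : X1 -> X1 -> R) (y1 : nat -> X1) (d2 : X2 -> X2 -> R) (y2 : nat -> X2).
Hypotheses (d1P : polish_distance d1 y1) (d2P : polish_distance d2 y2).

Definition unit_lift (q : X1 * (X2 * {nonneg R})) : cone R X1 * cone R X2 :=
  (cone_pt q.1 1%:nng, cone_pt q.2.1 q.2.2)%R.

Lemma continuous_unit_lift : continuous unit_lift.
Proof.
have c1 : continuous (fun q : X1 * (X2 * {nonneg R}) => (cone_pt q.1 1%:nng%R : cone R X1)).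
  move=> q A nA.
  have [[B C] [/= nB nC] BC] := @continuous_cone_pt R X1 (q.1, 1%:nng%R) A nA.
  exists (B, setT) => /=; first by split => //; exact: filterT.
  move=> [x w] [/= Bx _]; apply: (BC (x, 1%:nng%R)); split => //=.
  exact: nbhs_singleton nC.
have c2 : continuous (fun q : X1 * (X2 * {nonneg R}) => cone_pt q.2.1 q.2.2).
  move=> q A nA; have nA' := @continuous_cone_pt R X2 q.2 A nA.
  exists (setT, (fun z => cone_pt z.1 z.2) @^-1` A) => /=.
    by split => //; exact: filterT.
  by move=> [x w] [].
move=> q A [[B C] [/= nB nC] BC].
have qB : nbhs q ((fun q => (cone_pt q.1 1%:nng%R : cone R X1)) @^-1` B) := c1 q _ nB.
have qC : nbhs q ((fun q => cone_pt q.2.1 q.2.2) @^-1` C) := c2 q _ nC.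
by apply: filterS (filterI qB qC) => p [Bp Cp]; exact: BC.
Qed.

Let C := (cone R X1 * cone R X2)%type.

Lemma measurable_radius1 : measurable_fun setT (fun p : borel C => cone_radius p.1).
Proof.
apply: continuous_borel_real => p; apply: continuous_comp; first exact: cvg_fst.
exact: continuous_cone_radius.
Qed.

Lemma measurable_radius2 : measurable_fun setT (fun p : borel C => cone_radius p.2).
Proof.
apply: continuous_borel_real => p; apply: continuous_comp; first exact: cvg_snd.
exact: continuous_cone_radius.
Qed.

Lemma measurable_base1 :
  measurable_fun setT (fun p : borel C => cone_base0 p.1 : borel X1).
Proof.
exact: (measurableT_comp (@measurable_cone_base0 R X1)
  (@measurable_borel_fst (cone R X1) (cone R X2))).
Qed.

Lemma measurable_base2 :
  measurable_fun setT (fun p : borel C => cone_base0 p.2 : borel X2).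
Proof.
exact: (measurableT_comp (@measurable_cone_base0 R X2)
  (@measurable_borel_snd (cone R X1) (cone R X2))).
Qed.

Lemma over_base1E (A : set X1) :
  [set p : C | (0 < cone_radius p.1)%R /\ A (cone_base p.1)] =
  [set p : C | (0 < cone_radius p.1)%R] `&` (fun p : C => cone_base0 p.1) @^-1` A.
Proof.
by apply/seteqP; split=> p [/= r0]; rewrite /cone_base0 gt_eqF.
Qed.

Lemma over_base2E (A : set X2) :
  [set p : C | (0 < cone_radius p.2)%R /\ A (cone_base p.2)] =
  [set p : C | (0 < cone_radius p.2)%R] `&` (fun p : C => cone_base0 p.2) @^-1` A.
Proof.
by apply/seteqP; split=> p [/= r0]; rewrite /cone_base0 gt_eqF.
Qed.

Lemma measurable_pos1 : measurable ([set p | (0 < cone_radius p.1)%R] : set (borel C)).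
Proof.
have := measurable_radius1 measurableT (measurable_itv `]0%R, +oo[).
rewrite setTI (_ : _ @^-1` _ = [set p : C | (0 < cone_radius p.1)%R])//.
by apply/seteqP; split=> p /=; rewrite in_itv/= andbT.
Qed.

Lemma measurable_pos2 : measurable ([set p | (0 < cone_radius p.2)%R] : set (borel C)).
Proof.
have := measurable_radius2 measurableT (measurable_itv `]0%R, +oo[).
rewrite setTI (_ : _ @^-1` _ = [set p : C | (0 < cone_radius p.2)%R])//.
by apply/seteqP; split=> p /=; rewrite in_itv/= andbT.
Qed.

Lemma measurable_over1 (A : set (borel X1)) : measurable A ->
  measurable ([set p | (0 < cone_radius p.1)%R /\ A (cone_base p.1)] : set (borel C)).
Proof.
move=> mA; rewrite over_base1E; apply: measurableI; first exact: measurable_pos1.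
by rewrite -[X in measurable X]setTI; exact: measurable_base1.
Qed.

Lemma measurable_over2 (A : set (borel X2)) : measurable A ->
  measurable ([set p | (0 < cone_radius p.2)%R /\ A (cone_base p.2)] : set (borel C)).
Proof.
move=> mA; rewrite over_base2E; apply: measurableI; first exact: measurable_pos2.
by rewrite -[X in measurable X]setTI; exact: measurable_base2.
Qed.

(** The plan is built in two stages, through the graph of (T, g) in the Polish space
    [X1 * (X2 * {nonneg R})]: inner regularity holds there and is transported by the
    continuous map [unit_lift]. *)
Lemma unbalanced_le_monge (H : cone R X1 * cone R X2 -> \bar R)
    (mu1 : {finite_measure set (borel X1) -> \bar R})
    (mu2 : {finite_measure set (borel X2) -> \bar R}) :
  (forall p, 0 <= H p) -> continuous H ->
  unbalanced_cost H mu1 mu2 <= monge_cost H mu1 mu2.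
Proof.
move=> H0 cH; apply: le_ereal_inf_tmp => _ [Tg [mTg gint mu2E] <-].
have [d3 [y3 d3P]] := polish_distance_nonneg R.
have [d4 [y4 d4P]] := polish_distance_prod d2P d3P.
have [d5 [y5 d5P]] := polish_distance_prod d1P d4P.
have mgraph : measurable_fun setT
    ((fun x => (x, Tg x)) : borel X1 -> borel (X1 * (X2 * {nonneg R}))%type).
  exact: (borel_pair d1P d4P (@measurable_id _ _ _) mTg).
have mlift : measurable_fun setT
    (unit_lift : borel (X1 * (X2 * {nonneg R}))%type -> borel C).
  by apply: continuous_borel; exact: continuous_unit_lift.
have [m' m'E] := exists_image_measure mu1 mgraph.
have [alpha alphaE] := exists_image_measure m' mlift.
pose F (x : borel X1) : borel C := unit_lift (x, Tg x).
have mF : measurable_fun setT F by exact: measurableT_comp mlift mgraph.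
have intE (D : set (borel C)) (phi : borel C -> \bar R) : measurable D ->
    measurable_fun D phi -> (forall p, D p -> 0 <= phi p) ->
    \int[alpha]_(p in D) phi p = \int[mu1]_(x in F @^-1` D) phi (F x).
  move=> mD mphi phi0.
  rewrite (eq_measure_integral (pushforward mu1 F)); last first.
    by move=> A mA _; apply: etrans (alphaE A) _; rewrite /pushforward m'E.
  rewrite ge0_integral_pushforward//.
  by move=> p; rewrite inE; exact: phi0.
have mH : measurable_fun setT (H : borel C -> \bar R) by exact: continuous_borel_ereal.
have FE1 x : cone_radius (F x).1 = 1%R by rewrite cone_radiusE.
have FE2 x : cone_radius (F x).2 = (Tg x).2%:num by rewrite cone_radiusE.
apply: ereal_inf_lbound; exists alpha; last first.
  by rewrite intE// preimage_setT.
have mg : measurable_fun setT (fun x : borel X1 => (Tg x).2%:num).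
  by apply/measurable_EFinP; have /integrableP[] := gint.
split.
- apply: (image_radon d5P _ continuous_unit_lift) => [|A mA]; last exact: alphaE.
  have d2H := polish_hausdorff d2P; have d1H := polish_hausdorff d1P.
  by apply: hausdorff_prod; exact: cone_hausdorff.
- rewrite intE//; last 2 first.
  + apply/measurable_EFinP/measurable_funD; [exact: measurable_radius1|exact: measurable_radius2].
  + by move=> p _; rewrite lee_fin addr_ge0// cone_radius_ge0.
  rewrite preimage_setT; under eq_integral do rewrite FE1 FE2 EFinD.
  rewrite ge0_integralD//; last exact/measurable_EFinP.
  rewrite integral_cst// mul1e lte_add_pinfty//.
    by rewrite -ge0_fin_numE// fin_num_measure.
  have /integrableP[_ glt] := gint; apply: le_lt_trans glt.
  by rewrite le_eqVlt; apply/orP; left; apply/eqP/eq_integral => x _; rewrite gee0_abs.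
- move=> A mA; rewrite intE; last 3 first.
  + exact: measurable_over1.
  + by apply: measurable_funTS; apply/measurable_EFinP; exact: measurable_radius1.
  + by move=> p _; rewrite lee_fin cone_radius_ge0.
  under eq_integral do rewrite FE1.
  rewrite integral_cst; last first.
    by rewrite -[X in measurable X]setTI; apply: mF => //; exact: measurable_over1.
  rewrite mul1e; congr (mu1 _); apply/seteqP; split=> x /=.
    by move=> Ax; rewrite cone_radiusE cone_baseE//=; exact/eqP/oner_neq0.
  by move=> [_]; rewrite cone_baseE//=; exact/eqP/oner_neq0.
- move=> A mA; rewrite intE; last 3 first.
  + exact: measurable_over2.
  + by apply: measurable_funTS; apply/measurable_EFinP; exact: measurable_radius2.
  + by move=> p _; rewrite lee_fin cone_radius_ge0.
  rewrite mu2E// integral_mkcond [RHS]integral_mkcond.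
  apply: eq_integral => x _; rewrite !patchE FE2.
  have [g0|g0] := eqVneq (Tg x).2%:num 0%R; first by rewrite g0 !if_same.
  have gpos : (0 < (Tg x).2%:num)%R by rewrite lt_neqAle eq_sym g0/=.
  suff -> : (x \in F @^-1` [set p | (0 < cone_radius p.2)%R /\ A (cone_base p.2)]) =
      (x \in (fun x => (Tg x).1) @^-1` A) by [].
  apply/idP/idP; rewrite !inE /= cone_radiusE cone_baseE//; try exact/eqP.
  by move=> [].
Qed.

End homogeneous_lift.

(** * Weighted images of a measure *)

Section weighted_image.
Local Open Scope ereal_scope.
Import HBNNSimple.

Lemma ge0_integral_density d (T : measurableType d) (R : realType)
    (m nu : {measure set T -> \bar R}) (u : T -> R) (f : T -> \bar R) :
  measurable_fun setT u -> (forall x, 0 <= u x)%R ->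
  (forall A, measurable A -> nu A = \int[m]_(x in A) (u x)%:E) ->
  measurable_fun setT f -> (forall x, 0 <= f x) ->
  \int[nu]_x f x = \int[m]_x (f x * (u x)%:E).
Proof.
move=> mu u0 nuE mf f0.
pose f_ := nnsfun_approx measurableT mf.
have mue : measurable_fun setT (EFin \o u) by exact/measurable_EFinP.
have mf_ n : measurable_fun setT (EFin \o f_ n) by exact/measurable_EFinP.
have cvgf x : (f_ n x)%:E @[n --> \oo] --> f x by exact: cvg_nnsfun_approx.
have simple (g : {nnsfun T >-> R}) :
    \int[nu]_x (g x)%:E = \int[m]_x ((g x)%:E * (u x)%:E).
  have mgr r : measurable (g @^-1` [set r]) by [].
  rewrite integralT_nnsfun sintegralE.
  transitivity (\sum_(r \in range g)
      \int[m]_x ((r * \1_(g @^-1` [set r]) x)%:E * (u x)%:E)).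
    apply: eq_fsbigr => r; rewrite inE => -[x0 _ gr].
    have r0 : (0 <= r)%R by rewrite -gr.
    rewrite nuE// -ge0_integralZl_EFin//; last 2 first.
    - by move=> x _; rewrite lee_fin.
    - exact: measurable_funTS.
    rewrite integral_mkcond; apply: eq_integral => x _.
    by rewrite patchE indicE; case: ifP => _; rewrite ?mulr1 ?mulr0 ?mul0e.
  rewrite -ge0_integral_fsum//; last 2 first.
  - move=> r; apply: emeasurable_funM => //; apply/measurable_EFinP.
    by apply: measurable_funM => //; exact: measurable_indic.
  - by move=> r x _; rewrite mule_ge0 ?lee_fin// -lee_fin EFinM nnfun_muleindic_ge0.
  apply: eq_integral => x _; rewrite [in RHS]fimfunE -fsumEFin// ge0_mule_fsuml//.
  by move=> r; rewrite EFinM nnfun_muleindic_ge0.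
transitivity (limn (fun n => \int[nu]_x (f_ n x)%:E)).
  rewrite -monotone_convergence//.
  - by apply: eq_integral => x _; apply/esym/cvg_lim => //; exact: cvgf.
  - by move=> n x _; rewrite lee_fin.
  - by move=> x _ i j ij; rewrite lee_fin; exact/lefP/nd_nnsfun_approx.
under eq_fun do rewrite simple.
rewrite -monotone_convergence//.
- apply: eq_integral => x _; apply/cvg_lim => //.
  by apply: cvgeZr => //; exact: cvgf.
- by move=> n; exact: (emeasurable_funM (mf_ n) mue).
- by move=> n x _; rewrite mule_ge0 ?lee_fin.
- move=> x _ i j ij; apply: lee_wpmul2r; first by rewrite lee_fin.
  by rewrite lee_fin; exact/lefP/nd_nnsfun_approx.
Qed.

Lemma exists_weighted_image d d' (T : measurableType d) (T' : measurableType d')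
    (R : realType) (m : {finite_measure set T -> \bar R}) (u : T -> R) (g : T -> T') :
  measurable_fun setT u -> (forall x, 0 <= u x)%R -> \int[m]_x (u x)%:E < +oo ->
  measurable_fun setT g ->
  exists nu : {finite_measure set T' -> \bar R},
    forall f : T' -> \bar R, measurable_fun setT f -> (forall x, 0 <= f x) ->
    \int[nu]_y f y = \int[m]_x (f (g x) * (u x)%:E).
Proof.
move=> mu u0 ufin mg.
have mue : measurable_fun setT (EFin \o u) by exact/measurable_EFinP.
have [dens densE] : exists dens : {finite_measure set T -> \bar R},
    forall A, dens A = \int[m]_(x in A) (u x)%:E.
  apply: exists_finite_measure => //.
  - exact: integral_set0.
  - by move=> A; apply: integral_ge0 => x _; rewrite lee_fin.
  - move=> F mF tF mUF; rewrite ge0_integral_bigcup//; last 2 first.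
      exact: measurable_funTS.
      by move=> x _; rewrite lee_fin.
    apply: is_cvg_ereal_nneg_natsum_cond => n _ _.
    by apply: integral_ge0 => x _; rewrite lee_fin.
have [nu nuE] := exists_image_measure dens mg.
exists nu => f mf f0.
rewrite (eq_measure_integral (pushforward dens g)); last by move=> A mA _; exact: nuE.
rewrite ge0_integral_pushforward// preimage_setT.
apply: (@ge0_integral_density _ _ _ m dens u (f \o g)) => //.
- by move=> A _; exact: densE.
- exact: measurableT_comp.
- by move=> x; exact: f0.
Qed.

Lemma ge0_integral_indicr d (T : measurableType d) (R : realType)
    (m : {measure set T -> \bar R}) (A : set T) (f : T -> \bar R) :
  \int[m]_x ((\1_A x)%:E * f x) = \int[m]_(x in A) f x.
Proof.
rewrite [RHS]integral_mkcond; apply: eq_integral => x _.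
by rewrite patchE indicE; case: ifP => _; rewrite ?mul1e ?mul0e.
Qed.

End weighted_image.

(** * Normal form of a homogeneous plan *)

Section plan_normal_form.
Local Open Scope ereal_scope.
Context (R : realType) (X1 X2 : ptopologicalType).
Context (d1 : X1 -> X1 -> R) (y1 : nat -> X1) (d2 : X2 -> X2 -> R) (y2 : nat -> X2).
Hypotheses (d1P : polish_distance d1 y1) (d2P : polish_distance d2 y2).
Context (H : cone R X1 * cone R X2 -> \bar R).
Hypotheses (H0 : forall p, 0 <= H p) (H_homogeneous : radially_homogeneous H).
Hypothesis H_continuous : continuous H.

(** A total cast, meant for nonnegative arguments. *)
Definition nonneg_abs (a : R) : {nonneg R} := NngNum (normr_ge0 a).

Lemma nonneg_absE (a : R) : (0 <= a)%R -> (nonneg_abs a)%:num = a.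
Proof. by move=> a0; rewrite /= ger0_norm. Qed.

Lemma cone_pt_base0 (X : ptopologicalType) (p : cone R X) :
  cone_pt (cone_base0 p) (nonneg_abs (cone_radius p)) = p.
Proof.
have rE := nonneg_absE (cone_radius_ge0 p).
rewrite -[RHS]cone_pt_repr; apply/cone_pt_eqP; rewrite rE /cone_base0.
have [p0|p0] := eqVneq (cone_radius p) 0%R; first by right.
by left; split => //; [exact/val_inj|exact/eqP].
Qed.

Definition cone_vertex (X : ptopologicalType) : cone R X := cone_pt point 0%:nng%R.

(** Weight and radius are exchangeable: weight [u] on a point of radius 1 is worth
    radius [u], provided that the growth is divided by [u]. *)
Lemma homogeneous_unit_lift (u : R) (x : X1) (y : X2) (r : {nonneg R}) : (0 < u)%R ->
  u%:E * H (unit_lift (x, (y, nonneg_abs (r%:num / u)))) =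
  H (cone_pt x (nonneg_abs u), cone_pt y r).
Proof.
move=> u0; rewrite -(H_homogeneous (PosNum u0) x y 1%:nng%R).
congr (H (cone_pt _ _, cone_pt _ _)); apply/val_inj => /=.
  by rewrite mulr1 gtr0_norm.
by rewrite ger0_norm ?divr_ge0 ?(ltW u0)// mulrC divfK// gt_eqF.
Qed.

Lemma homogeneous_vertex (u : R) (y : X2) : (0 < u)%R ->
  u%:E * H (cone_vertex X1, cone_pt y 1%:nng%R) =
  H (cone_vertex X1, cone_pt y (nonneg_abs u)).
Proof.
move=> u0; rewrite -(H_homogeneous (PosNum u0) point y 0%:nng%R 1%:nng%R).
congr (H (cone_pt _ _, cone_pt _ _)); apply/val_inj => /=.
  by rewrite mulr0.
by rewrite mulr1 gtr0_norm.
Qed.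

Let C := (cone R X1 * cone R X2)%type.
Let W := (X1 * (X2 * {nonneg R}))%type.

Lemma measurable_nonneg_abs d (T : measurableType d) (f : T -> R) :
  measurable_fun setT f ->
  measurable_fun setT ((fun t => nonneg_abs (f t)) : T -> borel {nonneg R}).
Proof.
move=> mf; apply: measurable_nonneg => /=.
by apply: measurableT_comp => //; exact: measurable_normr.
Qed.

Lemma measurable_target : measurable_fun setT (fun q : borel W => q.2.1 : borel X2).
Proof.
exact: (measurableT_comp (@measurable_borel_fst X2 {nonneg R})
  (@measurable_borel_snd X1 (X2 * {nonneg R})%type)).
Qed.

Lemma measurable_growth : measurable_fun setT (fun q : borel W => (q.2.2)%:num : R).
Proof.
apply: (measurableT_comp (@measurable_borel_num R)).
exact: (measurableT_comp (@measurable_borel_snd X2 {nonneg R})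
  (@measurable_borel_snd X1 (X2 * {nonneg R})%type)).
Qed.

Lemma measurable_unit_cost : measurable_fun setT (fun q : borel W => H (unit_lift q)).
Proof.
apply: continuous_borel_ereal => q.
by apply: continuous_comp; [exact: continuous_unit_lift|exact: H_continuous].
Qed.

Lemma measurable_vertex_cost :
  measurable_fun setT (fun y : borel X2 => H (cone_vertex X1, cone_pt y 1%:nng%R)).
Proof.
apply: continuous_borel_ereal => y A /H_continuous [[B B'] [/= nB nB'] BB'].
have := @continuous_cone_pt R X2 (y, 1%:nng%R) _ nB'.
case=> -[V V'] [/= nV nV'] VV'; apply: filterS nV => z Vz; apply: BB'; split => /=.
  exact: nbhs_singleton nB.
apply: (VV' (z, 1%:nng%R)); split => //=; exact: nbhs_singleton nV'.
Qed.

Lemma measurable_indic_comp d d' (T : measurableType d) (T' : measurableType d')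
    (f : T -> T') (A : set T') : measurable_fun setT f -> measurable A ->
  measurable_fun setT (fun t => \1_A (f t) : R).
Proof. by move=> mf mA; apply: measurableT_comp => //; exact: measurable_indic. Qed.

(** [gamma] is the image of [r1 *: alpha] under division of the radii by [r1], and
    [nu] the image of [r2 *: alpha] on [r1 = 0] under the second base point. Points
    with both radii zero charge neither marginal and are lost, so that the cost may
    decrease. *)
Lemma plan_normal_form mu1 mu2 (alpha : {finite_measure set (borel C) -> \bar R}) :
  homogeneous_plans mu1 mu2 alpha ->
  exists (gamma : {finite_measure set (borel W) -> \bar R})
         (nu : {finite_measure set (borel X2) -> \bar R}),
  [/\ forall A : set (borel X1), measurable A -> mu1 A = gamma (fst @^-1` A),
      forall B : set (borel X2), measurable B ->
        mu2 B = \int[gamma]_q (\1_B q.2.1 * (q.2.2)%:num)%:E + nu B &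
      \int[gamma]_q H (unit_lift q) +
        \int[nu]_y H (cone_vertex X1, cone_pt y 1%:nng%R) <= \int[alpha]_p H p].
Proof.
move=> [_ rfin mu1E mu2E].
have [d3 [y3 d3P]] := polish_distance_nonneg R.
have [d4 [y4 d4P]] := polish_distance_prod d2P d3P.
have mr1 := @measurable_radius1 R X1 X2; have mr2 := @measurable_radius2 R X1 X2.
have mr1e : measurable_fun setT (fun p : borel C => (cone_radius p.1)%:E).
  exact/measurable_EFinP.
have mr2e : measurable_fun setT (fun p : borel C => (cone_radius p.2)%:E).
  exact/measurable_EFinP.
have r1ge (p : C) : (0 <= cone_radius p.1)%R by exact: cone_radius_ge0.
have r2ge (p : C) : (0 <= cone_radius p.2)%R by exact: cone_radius_ge0.
pose Phi (p : borel C) : borel W := (cone_base0 p.1,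
  (cone_base0 p.2, nonneg_abs (cone_radius p.2 / cone_radius p.1))).
have mPhi : measurable_fun setT Phi.
  apply: (borel_pair d1P d4P (@measurable_base1 R X1 X2)).
  apply: (borel_pair d2P d3P (@measurable_base2 R X1 X2)).
  apply: measurable_nonneg_abs; apply: measurable_funM => //.
  rewrite (_ : (fun p : borel C => _) = (fun p : borel C => powR (cone_radius p.1) (-1))).
    exact: (measurableT_comp (@measurable_powR R (-1)) mr1).
  by apply/funext => p; rewrite powR_inv1.
pose D : set (borel C) := [set p | cone_radius p.1 = 0%R].
have mD : measurable D.
  by have := mr1 measurableT _ (measurable_set1 0%R); rewrite setTI.
have mD1 : measurable_fun setT (\1_D : borel C -> R) by exact: measurable_indic.
pose u (p : borel C) : R := (\1_D p * cone_radius p.2)%R.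
have mu : measurable_fun setT u by exact: measurable_funM.
have u0 p : (0 <= u p)%R by rewrite mulr_ge0// r2ge.
have u_le p : (u p <= cone_radius p.2)%R.
  by rewrite /u indicE; case: (p \in D); rewrite ?mul1r ?mul0r.
have dom (v : borel C -> R) : (forall p, 0 <= v p <= cone_radius p.1 + cone_radius p.2)%R ->
    measurable_fun setT v -> \int[alpha]_p (v p)%:E < +oo.
  move=> hv mv; apply: le_lt_trans rfin; apply: ge0_le_integral => //.
  - by move=> p _; have /andP[] := hv p; rewrite lee_fin.
  - exact/measurable_EFinP.
  - by apply/measurable_EFinP; exact: measurable_funD.
  - by move=> p _; have /andP[] := hv p; rewrite lee_fin.
have [|gamma gammaE] := exists_weighted_image (m := alpha) mr1 r1ge _ mPhi.
  by apply: dom => // p; rewrite r1ge lerDl r2ge.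
have [|nu nuE] := exists_weighted_image (m := alpha) mu u0 _ (@measurable_base2 R X1 X2).
  by apply: dom => // p; rewrite u0/=; have := u_le p; have := r1ge p; lra.
have mh := measurable_unit_cost; have mv := measurable_vertex_cost.
have mH : measurable_fun setT (H : borel C -> \bar R) by exact: continuous_borel_ereal.
exists gamma, nu; split.
- move=> A mA.
  have mfA : measurable (fst @^-1` A : set (borel W)).
    by rewrite -[X in measurable X]setTI; exact: measurable_borel_fst.
  rewrite mu1E//.
  have -> : gamma (fst @^-1` A) = \int[gamma]_q (\1_(fst @^-1` A : set (borel W)) q)%:E.
    by rewrite integral_indic// setIT.
  rewrite gammaE//.
  + rewrite -ge0_integral_indicr; apply: eq_integral => p _.
    rewrite -!EFinM; congr EFin; have [r0|r0] := eqVneq (cone_radius p.1) 0%R.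
      by rewrite r0 !mulr0.
    have rpos : (0 < cone_radius p.1)%R by rewrite lt_neqAle eq_sym r0 r1ge.
    rewrite !indicE; suff -> : (p \in [set p : C | (0 < cone_radius p.1)%R /\ A (cone_base p.1)])
      = (Phi p \in (fst @^-1` A : set (borel W))) by [].
    by apply/idP/idP; rewrite !inE /= /cone_base0 (negbTE r0) => // -[].
  + exact/measurable_EFinP/measurable_indic.
- move=> B mB.
  have m1B : measurable_fun setT (fun q : borel W => \1_B q.2.1 : R).
    exact: measurable_indic_comp measurable_target mB.
  rewrite mu2E// gammaE; last 2 first.
  + by apply/measurable_EFinP; apply: measurable_funM => //; exact: measurable_growth.
  + by move=> q; rewrite lee_fin mulr_ge0.
  transitivity (\int[alpha]_p (((\1_B (Phi p).2.1 * ((Phi p).2.2)%:num)%:E * (cone_radius p.1)%:E)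
      + ((\1_B (cone_base0 p.2))%:E * (u p)%:E))); last first.
    rewrite ge0_integralD//.
    + congr (_ + _); rewrite -(nuE (fun y => (\1_B y)%:E)).
      * by rewrite integral_indic// setIT.
      * exact/measurable_EFinP/measurable_indic.
      * by move=> y; rewrite lee_fin.
    + by move=> p _; rewrite mule_ge0// lee_fin// mulr_ge0.
    + apply: emeasurable_funM => //; apply/measurable_EFinP.
      apply: measurable_funM.
        exact: (measurableT_comp m1B mPhi).
      exact: (measurableT_comp measurable_growth mPhi).
    + by move=> p _; rewrite mule_ge0// lee_fin.
    + apply: emeasurable_funM; apply/measurable_EFinP => //.
      exact: measurable_indic_comp (@measurable_base2 R X1 X2) mB.
  rewrite -ge0_integral_indicr; apply: eq_integral => p _.
  rewrite -!EFinM -EFinD; congr EFin; rewrite /u /= !indicE.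
  have -> : (p \in [set p : C | (0 < cone_radius p.2)%R /\ B (cone_base p.2)]) =
      (cone_radius p.2 != 0)%R && (cone_base0 p.2 \in B).
    apply/idP/idP; rewrite /cone_base0 !inE /=.
      by move=> [r0 Bp]; rewrite gt_eqF//=; exact: mem_set.
    case/andP => r0; rewrite (negbTE r0) inE => Bp; split => //.
    by rewrite lt_neqAle eq_sym r0 r2ge.
  have -> : (p \in D) = (cone_radius p.1 == 0)%R.
    by apply/idP/idP; rewrite inE => /eqP.
  have [r20|r20] := eqVneq (cone_radius p.2) 0%R.
    by rewrite r20 /= !(mul0r, mulr0, normr0, addr0).
  rewrite /=; have [r10|r10] := eqVneq (cone_radius p.1) 0%R.
    by rewrite r10 mulr0 add0r mul1r.
  by rewrite mul0r mulr0 addr0 ger0_norm ?divr_ge0 ?r1ge ?r2ge// -mulrA divfK.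
- rewrite gammaE// nuE// -ge0_integralD//; last 4 first.
  + by move=> p _; rewrite mule_ge0// lee_fin r1ge.
  + by apply: emeasurable_funM => //; exact: (measurableT_comp mh mPhi).
  + by move=> p _; rewrite mule_ge0// lee_fin.
  + apply: emeasurable_funM; last exact/measurable_EFinP.
    exact: (measurableT_comp mv (@measurable_base2 R X1 X2)).
  apply: ge0_le_integral => //.
  + by move=> p _; rewrite adde_ge0// mule_ge0// lee_fin// r1ge.
  + apply: emeasurable_funD.
      by apply: emeasurable_funM => //; exact: (measurableT_comp mh mPhi).
    apply: emeasurable_funM; last exact/measurable_EFinP.
    exact: (measurableT_comp mv (@measurable_base2 R X1 X2)).
  move=> p _; rewrite /u indicE.
  have -> : (p \in D) = (cone_radius p.1 == 0)%R.
    by apply/idP/idP; rewrite inE => /eqP.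
  have [r10|r10] := eqVneq (cone_radius p.1) 0%R.
    rewrite r10 mule0 add0e mul1r.
    have [r20|r20] := eqVneq (cone_radius p.2) 0%R; first by rewrite r20 mule0.
    have r2pos : (0 < cone_radius p.2)%R by rewrite lt_neqAle eq_sym r20 r2ge.
    rewrite muleC homogeneous_vertex// cone_pt_base0.
    suff -> : (cone_vertex X1, p.2) = p by [].
    case: p r10 {r20 r2pos} => p1 p2 /= r10; congr pair.
    by rewrite -(cone_pt_base0 p1); apply/cone_pt_eqP; right; rewrite /= r10 normr0.
  have r1pos : (0 < cone_radius p.1)%R by rewrite lt_neqAle eq_sym r10 r1ge.
  rewrite mul0r mule0 adde0 muleC /Phi.
  have -> : (cone_radius p.2 / cone_radius p.1)%R =
     ((nonneg_abs (cone_radius p.2))%:num / cone_radius p.1)%R by rewrite nonneg_absE.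
  by rewrite homogeneous_unit_lift// !cone_pt_base0; case: p {r10 r1pos}.
Qed.

End plan_normal_form.

(** * Sums, products and local bounds on the cost *)

Section product_and_sum.
Local Open Scope ereal_scope.

Lemma exists_product_measure d1 d2 (T1 : measurableType d1) (T2 : measurableType d2)
    (R : realType) (m1 : {finite_measure set T1 -> \bar R})
    (m2 : {finite_measure set T2 -> \bar R}) : m1 setT = 1 ->
  exists m : {finite_measure set (T1 * T2)%type -> \bar R},
    (forall A, measurable A -> m (fst @^-1` A) = m1 A * m2 setT) /\
    (forall B, measurable B -> m (snd @^-1` B) = m2 B).
Proof.
move=> m11; have m11' : (m1 : {measure set T1 -> \bar R}) setT = 1 := m11.
have [m mE] : exists m : {finite_measure set (T1 * T2)%type -> \bar R},
    forall A, m A = (m1 \x m2) A.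
  apply: exists_finite_measure.
  - exact: measure0.
  - by move=> A; exact: measure_ge0.
  - exact: (@measure_semi_sigma_additive _ _ _ (m1 \x m2)).
  - rewrite -setXTT product_measure1E// m11' mul1e.
    by rewrite -ge0_fin_numE// fin_num_measure.
exists m; split => [A mA|B mB]; rewrite mE.
- rewrite (_ : fst @^-1` A = A `*` setT) ?product_measure1E//.
  by apply/seteqP; split=> [[x z]|[x z] []].
- rewrite (_ : snd @^-1` B = setT `*` B) ?product_measure1E// ?m11' ?mul1e//.
  by apply/seteqP; split=> [[x z]|[x z] []].
Qed.

Lemma exists_measure_sum d (T : measurableType d) (R : realType)
    (m1 m2 : {finite_measure set T -> \bar R}) :
  exists m : {finite_measure set T -> \bar R},
    (forall A, m A = m1 A + m2 A) /\
    forall f, measurable_fun setT f -> (forall x, 0 <= f x) ->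
      \int[m]_x f x = \int[m1]_x f x + \int[m2]_x f x.
Proof.
have [m mE] : exists m : {finite_measure set T -> \bar R},
    forall A, m A = measure_add m1 m2 A.
  apply: exists_finite_measure.
  - exact: measure0.
  - by move=> A; exact: measure_ge0.
  - exact: measure_semi_sigma_additive.
  - by rewrite measure_addE lte_add_pinfty// -ge0_fin_numE// fin_num_measure.
exists m; split => [A|f mf f0]; first by rewrite mE measure_addE.
rewrite (eq_measure_integral (measure_add m1 m2)); last by move=> A _ _; exact: mE.
by rewrite ge0_integral_measure_add.
Qed.

Lemma measurable_fun_nat d (T : measurableType d) d' (T' : measurableType d')
    (c : T -> nat) (F : nat -> T') :
  (forall k, measurable (c @^-1` [set k])) -> measurable_fun setT (fun t => F (c t)).
Proof.
move=> mc _ B mB; rewrite setTI.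
exact: (measurable_preimage_nat (F @^-1` B) mc).
Qed.

Lemma integral_image d d' (T : measurableType d) (T' : measurableType d') (R : realType)
    (m : {finite_measure set T -> \bar R}) (m' : {finite_measure set T' -> \bar R})
    (g : T -> T') (f : T' -> \bar R) :
  measurable_fun setT g -> (forall A, measurable A -> m' A = m (g @^-1` A)) ->
  measurable_fun setT f -> (forall y, 0 <= f y) ->
  \int[m']_y f y = \int[m]_x f (g x).
Proof.
move=> mg m'E mf f0.
rewrite (eq_measure_integral (pushforward m g)); last by move=> A mA _; exact: m'E.
by rewrite ge0_integral_pushforward// preimage_setT.
Qed.

End product_and_sum.

Section near_cost.
Local Open Scope ereal_scope.
Context (R : realType) (X1 X2 : ptopologicalType).
Context (H : cone R X1 * cone R X2 -> \bar R).
Hypothesis H_continuous : continuous H.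
Variable e : R.
Hypothesis e0 : (0 < e)%R.

(** Mass can be removed from the source at these points at almost no cost. The
    exponent [n.+1] keeps the remaining fraction at least one half. *)
Definition shrinkable n : set (X1 * (X2 * {nonneg R})) :=
  [set q | forall t : {nonneg R}, (1 - 2 ^- n.+1 <= t%:num <= 1)%R ->
    H (cone_pt q.1 t, cone_pt q.2.1 q.2.2) <= H (unit_lift q) + e%:E].

Lemma near_shrinkable q : H (unit_lift q) \is a fin_num ->
  exists n, interior (shrinkable n) q.
Proof.
move=> hq; have e20 : (0 < e / 2)%R by rewrite divr_gt0.
have [[V V'] [/= nV nV'] VV'] := near_continuous_ereal H_continuous hq e20.
have [[B T] [/= nB nT] BT] := @continuous_cone_pt R X1 (q.1, 1%:nng%R) _ nV.
have /nbhs_nonneg[a a0 aT] := nT.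
have [n na] := exp2N_lt a0.
exists n; exists (B, (fun z => cone_pt z.1 z.2) @^-1` V') => /=.
  by split => //; exact: (@continuous_cone_pt R X2 q.2).
have inV x (t : {nonneg R}) : B x -> (1 - 2 ^- n.+1 <= t%:num <= 1)%R -> V (cone_pt x t).
  move=> Bx /andP[t1 t2]; apply: (BT (x, t)); split => //=; apply: aT => /=.
  rewrite ger0_norm ?subr_ge0//; have := exp2NS R n; have := exp2N_gt0 R n.+1; lra.
move=> [x [z r]] [/= Bx V'z] t ht /=.
have /andP[_ up] : H (unit_lift q) - (e / 2)%:E < H (cone_pt x t, cone_pt z r) <
    H (unit_lift q) + (e / 2)%:E.
  by apply: VV'; split => //=; exact: inV.
have /andP[lo _] : H (unit_lift q) - (e / 2)%:E < H (cone_pt x 1%:nng%R, cone_pt z r) <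
    H (unit_lift q) + (e / 2)%:E.
  apply: VV'; split => //=; apply: inV => //=; rewrite lexx andbT.
  by have := exp2N_gt0 R n.+1; lra.
apply/ltW/(lt_le_trans up); rewrite lteBlDr// in lo; apply/ltW.
by rewrite [in ltRHS](splitr e) EFinD addeA lteD2rE.
Qed.

(** The bound is uniform in the source point [x]. It can be met near every target of
    finite cost because a neighbourhood of the vertex contains all points of small
    radius. *)
Definition flat_at_vertex n : set X2 :=
  [set z | forall (x : X1) (t : {nonneg R}), (t%:num <= 2 ^- n)%R ->
    H (cone_pt x t, cone_pt z 1%:nng%R) <=
    H (cone_vertex R X1, cone_pt z 1%:nng%R) + e%:E].

Lemma near_flat_at_vertex z : H (cone_vertex R X1, cone_pt z 1%:nng%R) \is a fin_num ->
  exists n, interior (flat_at_vertex n) z.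
Proof.
move=> hz; have e20 : (0 < e / 2)%R by rewrite divr_gt0.
have [[V V'] [/= nV nV'] VV'] := near_continuous_ereal H_continuous hz e20.
rewrite nbhs_cone_vertex in nV; case: nV => a /= a0 aV.
have [[B T] [/= nB nT] BT] := @continuous_cone_pt R X2 (z, 1%:nng%R) _ nV'.
have [n na] := exp2N_lt a0.
exists n; rewrite /interior; apply: filterS nB => z' Bz' x t tn.
have V'z' : V' (cone_pt z' 1%:nng%R).
  by apply: (BT (z', 1%:nng%R)); split => //=; exact: nbhs_singleton nT.
have /andP[_ up] : H (cone_vertex R X1, cone_pt z 1%:nng%R) - (e / 2)%:E <
    H (cone_pt x t, cone_pt z' 1%:nng%R) <
    H (cone_vertex R X1, cone_pt z 1%:nng%R) + (e / 2)%:E.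
  by apply: VV'; split => //=; apply: aV; exists x, t; split => //; exact: le_lt_trans na.
have /andP[lo _] : H (cone_vertex R X1, cone_pt z 1%:nng%R) - (e / 2)%:E <
    H (cone_vertex R X1, cone_pt z' 1%:nng%R) <
    H (cone_vertex R X1, cone_pt z 1%:nng%R) + (e / 2)%:E.
  by apply: VV'; split => //=; apply: aV; exists point, 0%:nng%R; split.
apply/ltW/(lt_le_trans up); rewrite lteBlDr// in lo; apply/ltW.
by rewrite [in ltRHS](splitr e) EFinD addeA lteD2rE.
Qed.

End near_cost.

(** * Absorbing the singular part *)

Section absorption.
Local Open Scope ereal_scope.
Context (R : realType) (X1 X2 : ptopologicalType).
Context (d1 : X1 -> X1 -> R) (y1 : nat -> X1) (d2 : X2 -> X2 -> R) (y2 : nat -> X2).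
Hypotheses (d1P : polish_distance d1 y1) (d2P : polish_distance d2 y2).
Context (H : cone R X1 * cone R X2 -> \bar R).
Hypotheses (H0 : forall p, 0 <= H p) (H_homogeneous : radially_homogeneous H).
Hypothesis H_continuous : continuous H.

Let W := (X1 * (X2 * {nonneg R}))%type.
Let v (z : X2) := H (cone_vertex R X1, cone_pt z 1%:nng%R).

Lemma unit_cost_scaled (u : R) (x : X1) (z : X2) (r : {nonneg R}) : (0 < u)%R ->
  H (unit_lift (x, (z, nonneg_abs (r%:num / u)))) =
  (u^-1)%:E * H (cone_pt x (nonneg_abs u), cone_pt z r).
Proof.
move=> u0; rewrite -(homogeneous_unit_lift H_homogeneous x z r u0).
by rewrite muleA -EFinM mulVf ?gt_eqF// mul1e.
Qed.

(** On a set [K] of positive mass, a fraction [s] of [gamma] is removed and the growth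
    of the rest is raised by [1 / (1 - s)], which preserves the target mass. The mass
    removed, whose source has the first marginal of [gamma] on [K], is spread
    independently over the targets of [nu]: the target [z] gets source mass [w z] per
    unit of [nu], hence growth [1 / w z]. The total mass spread this way is
    [s * gamma K] for the appropriate [s], which is small when [w] is. *)
Lemma absorb_singular_part (gamma : {finite_measure set (borel W) -> \bar R})
    (nu : {finite_measure set (borel X2) -> \bar R}) (e : R) :
  0 < gamma setT -> \int[gamma]_q H (unit_lift q) < +oo -> (0 < e)%R ->
  exists gamma' : {finite_measure set (borel W) -> \bar R},
  [/\ forall A : set (borel X1), measurable A ->
        gamma' (fst @^-1` A) = gamma (fst @^-1` A),
      forall B : set (borel X2), measurable B ->
        \int[gamma']_q (\1_B q.2.1 * (q.2.2)%:num)%:E =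
        \int[gamma]_q (\1_B q.2.1 * (q.2.2)%:num)%:E + nu B &
      \int[gamma']_q H (unit_lift q) <=
        \int[gamma]_q H (unit_lift q) + \int[nu]_z v z
        + e%:E * (gamma setT + nu setT)].
Proof.
move=> gpos hfin e0.
have [d3 [y3 d3P]] := polish_distance_nonneg R.
have [d4 [y4 d4P]] := polish_distance_prod d2P d3P.
have mh := measurable_unit_cost H_continuous.
have mv : measurable_fun setT (v : borel X2 -> \bar R).
  exact: measurable_vertex_cost H_continuous.
have mfst := @measurable_borel_fst X1 (X2 * {nonneg R})%type.
have mtgt := @measurable_target R X1 X2; have mgr := @measurable_growth R X1 X2.
have mfstA (A : set (borel X1)) : measurable A -> measurable (fst @^-1` A : set (borel W)).
  by move=> mA; rewrite -[X in measurable X]setTI; exact: mfst.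
(* If all these sets were null, then so would be the set where the cost is finite,
   that is, all of [gamma]. *)
have mS n : measurable (interior (shrinkable H e n) : set (borel W)).
  by apply: open_borel; exact: open_interior.
have [n Kpos] : exists n, 0 < gamma (interior (shrinkable H e n)).
  apply: contrapT => none; move: gpos; rewrite lt_neqAle => /andP[/eqP + _]; apply.
  have [|N [mN N0 hN]] := @integrable_ae _ _ _ gamma setT measurableT
      (fun q : borel W => H (unit_lift q)).
    apply/integrableP; split => //; apply: le_lt_trans hfin; apply: ge0_le_integral => //.
    - exact: measurableT_comp.
    - by move=> q _; rewrite gee0_abs.
  apply/esym/(@negligibleP _ _ _ gamma) => //.
  apply: (@negligibleS _ _ _ gamma (N `|` \bigcup_n interior (shrinkable H e n))).
    move=> q _; have [hq|hq] := boolP (H (unit_lift q) \is a fin_num).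
      have [n hn] := near_shrinkable H_continuous e0 hq.
      by right; exists n.
    by left; apply: hN => /= /(_ I); exact/negP.
  apply: negligibleU; first exact/negligibleP.
  apply: negligible_bigcup => n; apply/negligibleP => //.
  by apply: contrapT => /eqP Kn; apply: none; exists n; rewrite measure_gt0.
pose K : set (borel W) := interior (shrinkable H e n).
rewrite -/K in Kpos; have mK : measurable K by exact: mS.
have Kfin : gamma K \is a fin_num by rewrite fin_num_measure.
pose k := fine (gamma K).
have k0 : (0 < k)%R by rewrite fine_gt0// Kpos -ge0_fin_numE.
pose M := fine (nu setT).
have M0 : (0 <= M)%R by exact: fine_ge0.
have ME : (nu : {measure set (borel X2) -> \bar R}) setT = M%:E.
  by apply/esym/fineK; exact: fin_num_measure.
(* The bound [c] on [w] makes [s] at most [2 ^- n.+1]; the summand 1 is for [nu] null. *)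
pose c : R := (2 ^- n.+1 * k / (1 + M))%R.
have M1 : (0 < 1 + M)%R by lra.
have c0 : (0 < c)%R by rewrite divr_gt0// mulr_gt0// exp2N_gt0.
(* [w z] is below the scale at which the cost is flat at [z]. *)
pose V j : set (borel X2) := interior (flat_at_vertex H e j).
have mV j : measurable (V j) by apply: open_borel; exact: open_interior.
pose w (z : borel X2) : R := Num.min c (2 ^- first_index V z).
have w0 z : (0 < w z)%R by rewrite lt_min c0 exp2N_gt0.
have wc z : (w z <= c)%R by rewrite ge_min lexx.
have mw (F : R -> R) : measurable_fun setT (fun z => F (w z)).
  apply: (measurable_fun_nat (fun j => F (Num.min c (2 ^- j)%R))) => j.
  exact: measurable_first_index.
have flat x z : H (cone_pt x (nonneg_abs (w z)), cone_pt z 1%:nng%R) <= v z + e%:E.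
  have [vz|vz] := boolP (v z \is a fin_num).
    have [j Vj] := near_flat_at_vertex H_continuous e0 vz.
    have [Vz _] := @first_indexP _ V j z Vj.
    apply: (interior_subset Vz); rewrite nonneg_absE; last exact: ltW.
    by rewrite ge_min lexx orbT.
  have -> : v z = +oo.
    by apply/eqP; rewrite -leye_eq leNgt; apply: contra vz => vz; rewrite ge0_fin_numE// H0.
  by rewrite addye// leey.
have mwid : measurable_fun setT w := mw id.
have [|sigma sigmaE] := @exists_weighted_image _ _ _ (borel X2) _ nu w id mwid
    (fun z => ltW (w0 z)) _ (@measurable_id _ (borel X2) setT).
  apply: (@le_lt_trans _ _ (\int[nu]_z c%:E)).
    apply: ge0_le_integral => //.
    - by move=> z _; rewrite lee_fin ltW.
    - exact/measurable_EFinP.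
    - by move=> z _; rewrite lee_fin wc.
  by rewrite integral_cst// ME -EFinM ltry.
have sT : sigma setT = \int[nu]_z (w z)%:E.
  rewrite -[LHS]mul1e -integral_cst// sigmaE//.
  by apply: eq_integral => z _; rewrite mul1e.
have sT_le : sigma setT <= (2 ^- n.+1 * k)%:E.
  rewrite sT; apply: (@le_trans _ _ (\int[nu]_z c%:E)).
    apply: ge0_le_integral => //.
    - by move=> z _; rewrite lee_fin ltW.
    - exact/measurable_EFinP.
    - by move=> z _; rewrite lee_fin wc.
  rewrite integral_cst// ME -EFinM lee_fin /c mulrAC ler_pdivrMr//.
  by rewrite ler_wpM2l ?mulr_ge0 ?ltW ?exp2N_gt0//; lra.
have sfin : sigma setT \is a fin_num by rewrite fin_num_measure.
pose s : R := (fine (sigma setT) / k)%R.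
have s0 : (0 <= s)%R by rewrite divr_ge0 ?fine_ge0// ltW.
have s_le : (s <= 2 ^- n.+1)%R by rewrite ler_pdivrMr// -lee_fin fineK.
have sE : sigma setT = (s * k)%:E by rewrite /s divfK ?gt_eqF// fineK.
(* The weight [theta] and the division of the growth by [theta] compensate. *)
pose theta (q : borel W) : R := (1 - s * \1_K q)%R.
have s1 : (s <= 1 / 2)%R.
  apply: le_trans s_le _; have := exp2NS R n; have : (2 ^- n <= 1 :> R)%R.
    by rewrite invf_le1 ?exprn_gt0// exprn_ege1// ler1n.
  lra.
have thetaE q : theta q = if q \in K then (1 - s)%R else 1%R.
  by rewrite /theta indicE; case: ifP => _; rewrite ?mulr1 ?mulr0 ?subr0.
have theta0 q : (0 < theta q)%R by rewrite thetaE; case: ifP => _; lra.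
have theta1 q : (theta q <= 1)%R by rewrite thetaE; case: ifP => _; lra.
have mtheta : measurable_fun setT theta.
  by apply: measurable_funB => //; apply: measurable_funM => //; exact: measurable_indic.
pose g1 (q : borel W) : borel W := (q.1, (q.2.1, nonneg_abs ((q.2.2)%:num / theta q))).
have mg1 : measurable_fun setT g1.
  apply: (borel_pair d1P d4P mfst); apply: (borel_pair d2P d3P mtgt).
  apply: measurable_nonneg_abs; apply: measurable_funM => //.
  rewrite (_ : (fun q : borel W => _) = (fun q : borel W => powR (theta q) (-1))).
    exact: (measurableT_comp (@measurable_powR R (-1)) mtheta).
  by apply/funext => q; rewrite powR_inv1// ltW.
have [|gamma1 gamma1E] := exists_weighted_image (m := gamma) mtheta
    (fun q => ltW (theta0 q)) _ mg1.
  apply: (@le_lt_trans _ _ (\int[gamma]_q 1)).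
    apply: ge0_le_integral => //.
    - by move=> q _; rewrite lee_fin ltW.
    - exact/measurable_EFinP.
    - by move=> q _; rewrite lee_fin.
  by rewrite integral_cst// mul1e -ge0_fin_numE// fin_num_measure.
(* [P] is the normalized first marginal of [gamma] on [K]; normalization makes
   [sigma] the second marginal of the product. *)
have [gK gKE] := exists_image_measure (mrestr gamma mK) mfst.
have ki0 : (0 <= k^-1)%R by rewrite invr_ge0 ltW.
pose P : {finite_measure set (borel X1) -> \bar R} := mscale (NngNum ki0) gK.
have PE A : P A = (k^-1)%:E * gamma (fst @^-1` A `&` K).
  by rewrite /P /= /mscale /= gKE.
have P1 : P setT = 1.
  by rewrite PE preimage_setT setTI -(fineK Kfin) -EFinM mulVf ?gt_eqF.
have [rho [rho1 rho2]] := exists_product_measure sigma P1.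
pose g2 (t : borel X1 * borel X2) : borel W := (t.1, (t.2, nonneg_abs (1 / w t.2))).
have mg2 : measurable_fun setT g2.
  apply: (borel_pair d1P d4P measurable_fst); apply: (borel_pair d2P d3P measurable_snd).
  apply: measurable_nonneg_abs.
  exact: (measurableT_comp (mw (fun a => 1 / a)%R) measurable_snd).
have [gamma2 gamma2E] := exists_image_measure rho mg2.
have int2 (f : borel W -> \bar R) : measurable_fun setT f -> (forall q, 0 <= f q) ->
    \int[gamma2]_q f q = \int[rho]_t f (g2 t).
  move=> mf f0; apply: integral_image mg2 _ mf f0 => A mA; exact: gamma2E.
have intrho (f : borel X2 -> \bar R) : measurable_fun setT f -> (forall z, 0 <= f z) ->
    \int[rho]_t f t.2 = \int[nu]_z (f z * (w z)%:E).
  move=> mf f0; rewrite -sigmaE//; apply/esym.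
  by apply: (integral_image measurable_snd) => // A mA; apply/esym; exact: rho2.
have [gamma' [gammaE' intE']] := exists_measure_sum gamma1 gamma2.
exists gamma'; split.
- move=> A mA; rewrite gammaE'.
  have -> : gamma1 (fst @^-1` A) = \int[gamma]_q ((\1_A q.1)%:E * (theta q)%:E).
    rewrite -[LHS](_ : \int[gamma1]_q (\1_(fst @^-1` A : set (borel W)) q)%:E = _).
      by rewrite gamma1E//; apply/measurable_EFinP; apply: measurable_indic; exact: mfstA.
    by rewrite integral_indic ?setIT//; exact: mfstA.
  have -> : gamma2 (fst @^-1` A) = \int[gamma]_q ((\1_A q.1)%:E * (s * \1_K q)%:E).
    rewrite gamma2E /pushforward (_ : g2 @^-1` _ = fst @^-1` A)// rho1// PE sE.
    rewrite muleAC -EFinM mulrCA mulVf ?gt_eqF// mulr1.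
    have mAK : measurable (fst @^-1` A `&` K : set (borel W)).
      by apply: measurableI => //; exact: mfstA.
    have -> : gamma (fst @^-1` A `&` K) =
        \int[gamma]_q (\1_(fst @^-1` A `&` K : set (borel W)) q)%:E.
      by rewrite integral_indic ?setIT.
    rewrite -ge0_integralZl_EFin//; last first.
      by apply/measurable_EFinP; exact: measurable_indic.
    apply: eq_integral => q _; rewrite -!EFinM; congr EFin.
    by rewrite indicI /= mulrCA.
  rewrite -ge0_integralD//; last 4 first.
  + by move=> q _; rewrite -EFinM lee_fin mulr_ge0// ltW.
  + apply: emeasurable_funM; apply/measurable_EFinP => //.
    exact: measurable_indic_comp mfst mA.
  + by move=> q _; rewrite mule_ge0// lee_fin// mulr_ge0.
  + apply: emeasurable_funM; apply/measurable_EFinP.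
      exact: measurable_indic_comp mfst mA.
    by apply: measurable_funM => //; exact: measurable_indic.
  transitivity (\int[gamma]_q (\1_(fst @^-1` A : set (borel W)) q)%:E).
    apply: eq_integral => q _; rewrite -!EFinM -EFinD; congr EFin.
    by rewrite -mulrDr /theta subrK mulr1.
  by rewrite integral_indic ?setIT//; exact: mfstA.
- move=> B mB.
  have mB1 : measurable_fun setT (fun q : borel W => \1_B q.2.1 : R).
    exact: measurable_indic_comp mtgt mB.
  have mf : measurable_fun setT (fun q : borel W => (\1_B q.2.1 * (q.2.2)%:num)%:E).
    by apply/measurable_EFinP; exact: measurable_funM.
  have f0 (q : borel W) : 0 <= (\1_B q.2.1 * (q.2.2)%:num)%:E.
    by rewrite lee_fin mulr_ge0.
  rewrite intE'// gamma1E// int2//; congr (_ + _).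
    apply: eq_integral => q _; rewrite -EFinM /g1 nonneg_absE.
      by rewrite -mulrA divfK ?gt_eqF.
    by rewrite divr_ge0// ltW.
  transitivity (\int[rho]_t (\1_B t.2 * (1 / w t.2))%:E).
    by apply: eq_integral => t _; rewrite /g2 nonneg_absE// divr_ge0// ltW.
  rewrite (intrho (fun z => (\1_B z * (1 / w z))%:E)); last 2 first.
  + apply/measurable_EFinP; apply: measurable_funM; first exact: measurable_indic.
    exact: (mw (fun a => 1 / a)%R).
  + by move=> z; rewrite lee_fin mulr_ge0// divr_ge0// ltW.
  transitivity (\int[nu]_z (\1_B z)%:E); last by rewrite integral_indic// setIT.
  by apply: eq_integral => z _; rewrite -EFinM -mulrA divfK ?gt_eqF// mulr1.
- rewrite intE'// gamma1E// int2//.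
  have bound1 : \int[gamma]_q (H (unit_lift (g1 q)) * (theta q)%:E) <=
      \int[gamma]_q (H (unit_lift q) + e%:E).
    apply: ge0_le_integral => //.
    + by move=> q _; rewrite mule_ge0// lee_fin ltW.
    + by apply: emeasurable_funM; [exact: (measurableT_comp mh mg1)|exact/measurable_EFinP].
    + exact: emeasurable_funD.
    move=> q _; rewrite /g1 unit_cost_scaled// muleC muleA -EFinM mulfV ?gt_eqF// mul1e.
    have [qK|qK] := boolP (q \in K).
      have Kq : K q by exact: set_mem.
      apply: (interior_subset Kq); rewrite nonneg_absE; last exact: ltW.
      by rewrite theta1 andbT thetaE qK; lra.
    rewrite (_ : nonneg_abs (theta q) = 1%:nng%R).
      by rewrite /unit_lift leeDl// lee_fin ltW.
    by apply/val_inj; rewrite /= thetaE (negbTE qK) normr1.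
  have bound2 : \int[rho]_t H (unit_lift (g2 t)) <= \int[nu]_z (v z + e%:E).
    have mb : measurable_fun setT (fun z : borel X2 => (1 / w z)%:E * (v z + e%:E)).
      apply: emeasurable_funM; last exact: emeasurable_funD.
      by apply/measurable_EFinP; exact: (mw (fun a => 1 / a)%R).
    have b0 z : 0 <= (1 / w z)%:E * (v z + e%:E).
      rewrite mule_ge0//; first by rewrite lee_fin divr_ge0// ltW.
      by rewrite adde_ge0// ?H0// lee_fin ltW.
    apply: (@le_trans _ _ (\int[rho]_t ((1 / w t.2)%:E * (v t.2 + e%:E)))).
      apply: ge0_le_integral => //.
      + exact: (measurableT_comp mh mg2).
      + exact: (measurableT_comp mb measurable_snd).
      move=> [x z] _; rewrite /g2 /= (unit_cost_scaled x z 1%:nng%R)// div1r.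
      by apply: lee_wpmul2l => //; rewrite lee_fin invr_ge0 ltW.
    rewrite (intrho _ mb b0) le_eqVlt; apply/orP; left; apply/eqP/eq_integral => z _.
    by rewrite muleAC -EFinM div1r mulVf ?gt_eqF// mul1e.
  apply: (le_trans (leeD bound1 bound2)).
  have e0' : 0 <= e%:E by rewrite lee_fin ltW.
  rewrite ge0_integralD// ge0_integralD//; last by move=> z _; exact: H0.
  by rewrite !integral_cst// ge0_muleDr// addeACA.
Qed.

End absorption.

(** * From homogeneous plans to transport maps *)

Section monge_le_unbalanced.
Local Open Scope ereal_scope.

Lemma monge_le_unbalanced (R : realType) (X1 X2 : ptopologicalType)
    (d1 : X1 -> X1 -> R) y1 (d2 : X2 -> X2 -> R) y2
    (H : cone R X1 * cone R X2 -> \bar R)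
    (mu1 : {finite_measure set (borel X1) -> \bar R})
    (mu2 : {finite_measure set (borel X2) -> \bar R}) :
  polish_distance d1 y1 -> polish_distance d2 y2 ->
  (forall p, 0 <= H p) -> radially_homogeneous H -> continuous H ->
  diffuse mu1 -> 0 < mu1 setT ->
  monge_cost H mu1 mu2 <= unbalanced_cost H mu1 mu2.
Proof.
move=> d1P d2P H0 H_homogeneous H_continuous mu1_diffuse mu1_gt0.
apply: le_ereal_inf_tmp => _ [alpha plan <-].
have [->|Hfin] := eqVneq (\int[alpha]_p H p) +oo; first exact: leey.
rewrite -ltey in Hfin.
have [gamma [nu [mu1E mu2E cost]]] := plan_normal_form d1P d2P H0 H_homogeneous H_continuous plan.
have gT : gamma setT = mu1 setT by rewrite mu1E// preimage_setT.
have h0 (q : X1 * (X2 * {nonneg R})) : 0 <= H (unit_lift q) by exact: H0.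
have nu_ge0 : 0 <= \int[nu]_y H (cone_vertex R X1, cone_pt y 1%:nng%R).
  by apply: integral_ge0 => y _; exact: H0.
have gfin : \int[gamma]_q H (unit_lift q) < +oo.
  by apply: le_lt_trans Hfin; apply: le_trans cost; rewrite leeDl.
have gpos : 0 < gamma setT by rewrite gT.
have fa : mu1 setT \is a fin_num by rewrite fin_num_measure.
have fb : nu setT \is a fin_num by rewrite fin_num_measure.
pose a := fine (mu1 setT); pose b := fine (nu setT).
have a0 : (0 <= a)%R by exact: fine_ge0.
have b0 : (0 <= b)%R by exact: fine_ge0.
apply/lee_addgt0Pr => e e0.
have D0 : (0 < 2 * a + b + 1)%R by lra.
(* Absorption spends [e'] per unit of mass of [gamma] and [nu], and the passage to a
   map once more per unit of mass of [gamma']. *)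
pose e' := (e / (2 * a + b + 1))%R.
have e'0 : (0 < e')%R by rewrite divr_gt0.
have [gamma' [marg1 marg2 cost']] :=
  absorb_singular_part d1P d2P H0 H_homogeneous H_continuous nu gpos gfin e'0.
have [d3 [y3 d3P]] := polish_distance_nonneg R.
have [d4 [y4 d4P]] := polish_distance_prod d2P d3P.
have marg (A : set (borel X1)) : measurable A -> mu1 A = gamma' (fst @^-1` A).
  by move=> mA; rewrite marg1// mu1E.
have ch : continuous (fun q : X1 * (X2 * {nonneg R}) => H (unit_lift q)).
  by move=> q; apply: continuous_comp; [exact: continuous_unit_lift|exact: H_continuous].
have total : e'%:E * (gamma setT + nu setT) + e'%:E * gamma' setT <= e%:E.
  have -> : gamma' setT = mu1 setT by rewrite marg// preimage_setT.
  have aE : mu1 setT = a%:E by rewrite /a fineK.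
  have bE : nu setT = b%:E by rewrite /b fineK.
  rewrite gT aE bE -EFinD lee_fin.
  rewrite -mulrDr /e' mulrAC ler_pdivrMr// ler_wpM2l ?ltW//; lra.
have bound : \int[gamma']_q H (unit_lift q) + e'%:E * gamma' setT <=
    \int[alpha]_p H p + e%:E.
  apply: le_trans (leeD cost total); rewrite addeA.
  by apply: leeD => //; exact: cost'.
have g'fin : \int[gamma']_q H (unit_lift q) < +oo.
  apply: (@le_lt_trans _ _ (\int[alpha]_p H p + e%:E)); last by rewrite lte_add_pinfty// ltry.
  by apply: le_trans bound; rewrite leeDl// mule_ge0// lee_fin ltW.
have [S [mS SB Scost]] := monge_approximation d1P d4P mu1_diffuse marg ch h0 g'fin e'0.
have mgr : measurable_fun setT (fun z : borel (X2 * {nonneg R})%type => z.2%:num : R).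
  exact: (measurableT_comp (@measurable_borel_num R) (@measurable_borel_snd X2 {nonneg R})).
have mtgt := @measurable_borel_fst X2 {nonneg R}.
have msnd := @measurable_borel_snd X1 (X2 * {nonneg R})%type.
have [m' m'E] := exists_image_measure mu1 mS.
have intS (f : borel (X2 * {nonneg R})%type -> \bar R) : measurable_fun setT f ->
    (forall z, 0 <= f z) -> \int[mu1]_x f (S x) = \int[gamma']_q f q.2.
  move=> mf f0; transitivity (\int[m']_z f z).
    by apply/esym; apply: (integral_image mS) => // A mA; exact: m'E.
  by apply: (integral_image msnd) => // A mA; rewrite m'E /pushforward SB.
have mu2S (B : set (borel X2)) : measurable B ->
    mu2 B = \int[mu1]_(x in (fun x => (S x).1) @^-1` B) ((S x).2%:num)%:E.
  move=> mB; rewrite mu2E// -marg2//.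
  rewrite -(intS (fun z => (\1_B z.1 * z.2%:num)%:E)); last 2 first.
  - apply/measurable_EFinP; apply: measurable_funM => //.
    exact: measurable_indic_comp mtgt mB.
  - by move=> z; rewrite lee_fin mulr_ge0.
  rewrite -[RHS]ge0_integral_indicr; apply: eq_integral => x _.
  by rewrite EFinM !indicE.
apply: le_trans bound; apply: le_trans Scost.
apply: ereal_inf_lbound; exists S => //; split => //.
apply/integrableP; split.
  by apply/measurable_EFinP; exact: (measurableT_comp mgr mS).
apply: (@le_lt_trans _ _ (mu2 setT)); last by rewrite -ge0_fin_numE// fin_num_measure.
rewrite mu2S// preimage_setT; apply: ge0_le_integral => //.
- by apply: measurableT_comp => //; apply/measurable_EFinP; exact: (measurableT_comp mgr mS).
- by apply/measurable_EFinP; exact: (measurableT_comp mgr mS).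
- by move=> x _; rewrite gee0_abs.
Qed.

End monge_le_unbalanced.

Theorem theorem2 (R : realType) (X1 X2 : ptopologicalType)
  (polish_X1 : polish_space R X1) (polish_X2 : polish_space R X2)
  (H : cone R X1 * cone R X2 -> \bar R)
  (H_ge0 : forall p, (0 <= H p)%E)
  (H_proper : exists p, H p <> +oo%E)
  (H_homogeneous : radially_homogeneous H)
  (H_continuous : continuous H)
  (mu1 : {finite_measure set (borel X1) -> \bar R})
  (mu2 : {finite_measure set (borel X2) -> \bar R})
  (mu1_diffuse : diffuse mu1)
  (mu1_gt0 : (0 < mu1 [set: X1])%E) :
  unbalanced_cost H mu1 mu2 = monge_cost H mu1 mu2.
Proof.
have [d1 [y1 d1P]] := polish_space_distance polish_X1.
have [d2 [y2 d2P]] := polish_space_distance polish_X2.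
apply/eqP; rewrite eq_le; apply/andP; split.
  exact: (unbalanced_le_monge d1P d2P mu1 mu2 H_ge0 H_continuous).
exact: (monge_le_unbalanced _ d1P d2P).
Qed.
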